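(* Let $(T_\xi)$ be a family of operators $T_\xi\colon\mathcal H\to\mathcal H$, with $\xi\sim\mathcal D$, such that $T_\xi$ is nonexpansive for $\mathcal D$-almost all $\xi$ and, for each $x\in\mathcal H$, the map $\xi\mapsto T_\xi x$ is measurable and Bochner integrable. Define $Tx=\mathbb E_{\xi\sim\mathcal D}[T_\xi x]$ and assume $\mathrm{Fix}(T)\neq\emptyset$. Assume that for some $p_0\in\mathrm{Fix}(T)$, $\mathbb E[\|(T_\xi-T)p_0\|^2]\le\sigma_*^2<+\infty$. Let $x_0\in\mathcal H$ and let $(x_k)$ be the random iterates of the stochastic Krasnoselskii-Mann algorithm $x_{k+1}=(1-\lambda_k)x_k+\lambda_kT_{\xi_k}(x_k)$, where $\xi_0,\xi_1,\dots$ are drawn independently from $\mathcal D$. Let $\bar\lambda\in(0,1)$ be a constant. Then, with the random index $N_K$ defined in the context: 1. (Polynomially decreasing relaxation) If $\lambda_k=\bar\lambda(k+1)^{-a}$ with $a\in(1/2,1]$, then, for $K\ge1$, $$\mathbb E[\|Tx_{N_K}-x_{N_K}\|]\le\begin{cases}\mathcal O(K^{-\frac{1-a}2})&\text{if }a<1,\\ \mathcal O(\ln(K)^{-\frac12})&\text{if }a=1,\end{cases}$$ and, almost surely as $K\to\infty$, $$\min_{k\le K-1}\|Tx_k-x_k\|\le\begin{cases}o(K^{-\frac{1-a}2})&\text{if }a<1,\\ o(\ln(K)^{-\frac12})&\text{if }a=1.\end{cases}$$ Moreover, $$\mathbb E[\|Tx_K-x_K\|]\le\begin{cases}\mathcal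 O(K^{-\frac{2a-1}2})&\text{if }1/2<a<2/3,\\ \mathcal O(\ln(K)^{\frac12}K^{-\frac16})&\text{if }a=2/3,\\ \mathcal O(K^{-\frac{1-a}2})&\text{if }2/3<a<1,\\ \mathcal O(\ln(K)^{-\frac12})&\text{if }a=1.\end{cases}$$ 2. (Poly-logarithmically decreasing relaxation) If $\lambda_k=\bar\lambda(k+1)^{-a}\ln(k+e)^{-1}$ with $a\in[1/2,1]$, then, for $K\ge3$, $$\mathbb E[\|Tx_{N_K}-x_{N_K}\|]\le\begin{cases}\mathcal O(K^{-\frac{1-a}2}\ln(K)^{\frac12})&\text{if }1/2\le a<1,\\ \mathcal O((\ln\ln K)^{-\frac12})&\text{if }a=1,\end{cases}$$ and, almost surely as $K\to\infty$, $$\min_{k\le K-1}\|Tx_k-x_k\|\le\begin{cases}o(K^{-\frac{1-a}2}\ln(K)^{\frac12})&\text{if }1/2\le a<1,\\ o((\ln\ln K)^{-\frac12})&\text{if }a=1.\end{cases}$$ 3. (Constant horizon-dependent relaxation) If, for a horizon $K\ge1$, $\lambda_k\equiv\bar\lambda K^{-a}$ with $a\in[1/2,1)$, then $$\mathbb E[\|Tx_{N_K}-x_{N_K}\|]\le\mathcal O\left(K^{-\min(a,1-a)/2}\right)\quad\text{and}\quad\mathbb E[\|Tx_K-x_K\|]\le\mathcal O\left(K^{-\min(-1+2a,1-a)/2}\right).$$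
   Context: $\mathcal H$ is a real separable Hilbert space with norm $\|\cdot\|$, and $\mathcal D$ is a probability distribution. An operator $S$ is nonexpansive if $\|Sx-Sy\|\le\|x-y\|$ for all $x,y\in\mathcal H$. $\mathrm{Fix}(T)=\{x\colon Tx=x\}$. The starting point $x_0$ is a fixed (deterministic) point. Define $\Lambda_k=\prod_{i=0}^{k-1}(1+2\lambda_i^2)^{-1}$. The random index $N_K\in\{0,\dots,K-1\}$ is independent of the algorithmic randomness $(\xi_k)$ and satisfies $$\mathbb P(N_K=k)=\frac{\Lambda_{k+1}\lambda_k(1-\lambda_k)}{\sum_{k'=0}^{K-1}\Lambda_{k'+1}\lambda_{k'}(1-\lambda_{k'})},\quad k=0,\dots,K-1.$$ $\mathbb E$ is taken over all sources of randomness, including $N_K$. In item 3, for each horizon $K$ the algorithm is run afresh for $K$ iterations with the constant parameter $\bar\lambda K^{-a}$. $\mathcal O(\cdot)$ and $o(\cdot)$ are understood asymptotically as $K\to\infty$, with constants not depending on $K$. *)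

(* Defs.v *)
From HB Require Import structures.
From mathcomp Require Import all_boot all_order all_algebra.
From mathcomp Require Import finmap.
From mathcomp Require Import all_classical all_reals all_analysis.

Set Implicit Arguments.
Unset Strict Implicit.
Unset Printing Implicit Defensive.

Import Order.TTheory GRing.Theory Num.Theory.
Import numFieldNormedType.Exports.

Local Open Scope classical_set_scope.
Local Open Scope ring_scope.

Definition separable (X : topologicalType) : Prop :=
  exists2 A : set X, countable A & dense A.

Definition nonexpansive (R : realType) (H : normedModType R) (S : H -> H) :
  Prop := forall x y : H, `|S x - S y| <= `|x - y|.

Definition Fix (X : Type) (S : X -> X) : set X := [set x | S x = x].

Section Bochner.
Context (R : realType) (d : measure_display) (X : measurableType d)
        (H : completeNormedModType R) (mu : probability X R).

Definition borel_measurable (f : X -> H) : Prop :=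
  measurable_fun setT (f : X -> g_sigma_algebraType (@open H)).

Definition simple_function (s : X -> H) : Prop :=
  borel_measurable s /\ finite_set (range s).

Definition simple_integral (s : X -> H) : H :=
  \sum_(v \in range s) fine (mu (s @^-1` [set v])) *: v.

Definition bochner_approx (f : X -> H) (s : nat -> X -> H) : Prop :=
  (forall n, simple_function (s n)) /\
  (fun n => \int[mu]_w (`|f w - s n w|)%:E)%E @ \oo --> 0%E.

Definition bochner_integrable (f : X -> H) : Prop :=
  exists s, bochner_approx f s.

(* The limit does not depend on the approximating sequence; the value is
   a default one when f is not Bochner integrable. *)
Definition bochner_integral (f : X -> H) : H :=
  get [set v | exists2 s, bochner_approx f s &
                 (fun n => simple_integral (s n)) @ \oo --> v].

End Bochner.

Section Independence.
Context (R : realType) (d d' : measure_display) (Omega : measurableType d)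
        (Xi : measurableType d') (P : probability Omega R).

Definition mutually_independent (X : nat -> Omega -> Xi) : Prop :=
  forall (J : {fset nat}) (A : nat -> set Xi), (forall j, measurable (A j)) ->
    P (\bigcap_(j in [set` J]) X j @^-1` A j) =
    (\prod_(j <- J) P (X j @^-1` A j))%E.

Definition process_sigma_algebra (X : nat -> Omega -> Xi) : set (set Omega) :=
  <<s \bigcup_j preimage_set_system setT (X j) measurable >>.

Definition independent_of_process (N : Omega -> nat) (X : nat -> Omega -> Xi) :
  Prop :=
  forall (A : set nat) (B : set Omega), process_sigma_algebra X B ->
    P (N @^-1` A `&` B) = (P (N @^-1` A) * P B)%E.

Definition iid_from (D : probability Xi R) (X : nat -> {RV P >-> Xi}) : Prop :=
  (forall k (A : set Xi), measurable A -> distribution P (X k) A = D A) /\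
  mutually_independent X.

End Independence.

Section StochasticKM.
Context (R : realType) (d d' : measure_display) (Omega : measurableType d)
        (Xi : measurableType d') (H : completeNormedModType R).

Definition mean_operator (D : probability Xi R) (T : Xi -> H -> H) (x : H) : H :=
  bochner_integral D (fun s => T s x).

Fixpoint skm (T : Xi -> H -> H) (lambda : nat -> R) (x0 : H)
    (xi : nat -> Omega -> Xi) (k : nat) (w : Omega) : H :=
  if k is k'.+1 then
    let x := skm T lambda x0 xi k' w in
    (1 - lambda k') *: x + lambda k' *: T (xi k' w) x
  else x0.

(* T s is nonexpansive only for D-almost every s, so the iterates skm, hence
   this residual, are measurable only up to a P-null set. The library integral
   of a nonnegative function, a supremum over simple functions below it, agrees
   with that of any measurable modification. *)
Definition residual (D : probability Xi R) (T : Xi -> H -> H)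
    (lambda : nat -> R) (x0 : H) (xi : nat -> Omega -> Xi) (k : nat)
    (w : Omega) : R :=
  let x := skm T lambda x0 xi k w in `|mean_operator D T x - x|.

(* For K >= 1 this is the minimum over k <= K - 1: the initial value of the
   iterated minimum is the term of index 0. *)
Definition min_residual (D : probability Xi R) (T : Xi -> H -> H)
    (lambda : nat -> R) (x0 : H) (xi : nat -> Omega -> Xi) (K : nat)
    (w : Omega) : R :=
  \big[Num.min/residual D T lambda x0 xi 0 w]_(k < K)
    residual D T lambda x0 xi k w.

Definition Lambda (lambda : nat -> R) (k : nat) : R :=
  \prod_(i < k) (1 + 2 * lambda i ^+ 2)^-1.

Definition index_weight (lambda : nat -> R) (k : nat) : R :=
  Lambda lambda k.+1 * lambda k * (1 - lambda k).

Definition random_index (P : probability Omega R) (lambda : nat -> R)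
    (xi : nat -> Omega -> Xi) (K : nat) (N : Omega -> nat) : Prop :=
  [/\ forall w, (N w < K)%N,
      forall k, (k < K)%N ->
        P (N @^-1` [set k]) =
        (index_weight lambda k / \sum_(k' < K) index_weight lambda k')%:E
    & independent_of_process P N xi].

End StochasticKM.

(* Big-O for a sequence of expectations: they are real numbers from index n0
   on, and O(r) as K tends to infinity. *)
Definition expectation_bigO (R : realType) (n0 : nat) (u : nat -> \bar R)
    (r : nat -> R) : Prop :=
  (forall K, (n0 <= K)%N -> u K \is a fin_num) /\
  (fun K => fine (u K) : R^o) =O_\oo (r : nat -> R^o).

Definition almost_surely_littleo (R : realType) (d : measure_display)
    (Omega : measurableType d) (P : probability Omega R)
    (u : nat -> Omega -> R) (r : nat -> R) : Prop :=
  {ae P, forall w, (fun K => u K w : R^o) =o_\oo (r : nat -> R^o)}.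

(* Main.v *)
Require Import Defs.
From HB Require Import structures.
From mathcomp Require Import all_boot all_order all_algebra.
From mathcomp Require Import finmap.
From mathcomp Require Import all_classical all_reals all_analysis.
From mathcomp Require Import measurable_realfun ring lra.

Set Implicit Arguments.
Unset Strict Implicit.
Unset Printing Implicit Defensive.

Import Order.TTheory GRing.Theory Num.Theory.
Import numFieldNormedType.Exports.

Local Open Scope classical_set_scope.
Local Open Scope ring_scope.

(* Write M for the mean operator, defect x = |M x - x|, and e_k for the centred
   noise of step k. Expanding |x_{k+1} - p|^2 and using E[e_k | past] = 0 gives
     E|x_{k+1} - p|^2 + l_k (1 - l_k) E (defect x_k)^2
       <= (1 + 8 l_k^2) E|x_k - p|^2 + 2 l_k^2 sigma^2,
   so that, when sum l_k^2 is bounded, E|x_k - p|^2 and sum l_k E (defect x_k)^2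
   are bounded. This yields the bound for the random index, and the almost sure
   bound because sum l_k (defect x_k)^2 is then almost surely finite.

   For the last iterate, run from x_k the noiseless iteration
   z <- (1 - l_j) z + l_j M z. Its defect does not increase and its steps are
   nonexpansive, hence E|x_K - z_K|^2 <= C sum_{k <= j < K} l_j^2 and
     E (defect x_K)^2 <= 2 E (defect x_k)^2 + 8 C sum_{k <= j < K} l_j^2.
   Averaging over k in a window [m, K) with weights l_k gives
     E (defect x_K)^2 <= C' / sum_{m <= k < K} l_k + C' sum_{m <= k < K} l_k^2,
   with m = K/2 if a < 1, m = (ln K)/2 if a = 1, m = 0 for a constant parameter.

   Only weak properties of the Bochner integral are needed:
   <M x, h> = E <T_xi x, h>. *)

(** * Inner product and Borel measurability *)

(** The operators are nonexpansive only almost surely, so the iterates need not be measurable. All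
    moments are therefore computed for a version [S] that is nonexpansive at every sample, and the
    residuals are compared with it almost everywhere. Conditional expectations are avoided: the
    iterate at time [k] and the sample [xi k] have a product law, so Tonelli allows integrating
    first over the sample with the iterate frozen. The outer integrands are squares, hence
    nonnegative; the signed cross term is met only in the inner integral, where the point of [H] is
    held fixed. This requires joint measurability in the point and the sample, which separability
    and the Lipschitz property provide. The parameters enter the constants only through a bound [Q]
    on the sum of their squares up to the horizon, the lower bound [delta] of [1 - lambda k], and
    sums of the parameters measured against the rate. The same estimates thus serve a schedule that
    changes with the horizon. First moments are deduced from second moments by Young's inequality at
    a scale equal to the desired rate. *)

Section InnerProduct.
Context (R : realType) (H : completeNormedModType R) (dot : {dot H for idfun})
        (norm_dot : forall x : H, dot x x = `|x| ^+ 2).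

Lemma dotC (x y : H) : dot x y = dot y x.
Proof. by rewrite hermC expr0 mul1r. Qed.

Lemma dotDl (x y z : H) : dot (x + y) z = dot x z + dot y z.
Proof. exact: linearDl. Qed.

Lemma dotZl (a : R) (x z : H) : dot (a *: x) z = a * dot x z.
Proof. exact: linearZl_LR. Qed.

Lemma dotNl (x z : H) : dot (- x) z = - dot x z.
Proof. exact: linearNl. Qed.

Lemma dotBl (x y z : H) : dot (x - y) z = dot x z - dot y z.
Proof. by rewrite dotDl dotNl. Qed.

Lemma sqr_normD (x y : H) : `|x + y| ^+ 2 = `|x| ^+ 2 + 2 * dot x y + `|y| ^+ 2.
Proof.
rewrite -!norm_dot dotDl (dotC x (x + y)) (dotC y (x + y)) !dotDl (dotC y x).
by ring.
Qed.

Lemma sqr_normB (x y : H) : `|x - y| ^+ 2 = `|x| ^+ 2 - 2 * dot x y + `|y| ^+ 2.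
Proof. by rewrite sqr_normD (dotC x) dotNl normrN mulrN (dotC x). Qed.

Lemma polarization (x y : H) :
  dot x y = (`|x + y| ^+ 2 - `|x| ^+ 2 - `|y| ^+ 2) / 2.
Proof. by rewrite sqr_normD; field. Qed.

Lemma dot_le (x y : H) : dot x y <= `|x| * `|y|.
Proof.
have [->|x0] := eqVneq x 0.
  by rewrite -(scale0r 0) dotZl mul0r scale0r normr0 mul0r.
have [->|y0] := eqVneq y 0.
  by rewrite dotC -(scale0r 0) dotZl mul0r scale0r normr0 mulr0.
have nx : 0 < `|x| by rewrite normr_gt0.
have ny : 0 < `|y| by rewrite normr_gt0.
(* Cauchy-Schwarz: the two scaled vectors have equal norm, so this square factors as
   [2 |x| |y| (|x| |y| - dot x y)]. *)
have : 0 <= `|(`|y| *: x - `|x| *: y)| ^+ 2 by rewrite sqr_ge0.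
rewrite sqr_normB !normrZ !normr_id dotZl (dotC x) dotZl (dotC y).
rewrite [X in 0 <= X -> _](_ : _ =
  2 * (`|x| * `|y|) * (`|x| * `|y| - dot x y)); last by ring.
by rewrite pmulr_rge0 ?subr_ge0 // !mulr_gt0.
Qed.

Lemma norm_dot_le (x y : H) : `|dot x y| <= `|x| * `|y|.
Proof.
rewrite ler_norml dot_le andbT lerNl.
by have := dot_le (- x) y; rewrite normrN dotNl.
Qed.

(** The last term is the gain from averaging. With [y] the image of [x] under the mean operator,
    both shifted by the fixed point, [|y - x|] is the defect. *)
Lemma sqr_norm_convex (l : R) (x y : H) :
  `|(1 - l) *: x + l *: y| ^+ 2 =
  (1 - l) * `|x| ^+ 2 + l * `|y| ^+ 2 - l * (1 - l) * `|y - x| ^+ 2.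
Proof.
rewrite (sqr_normD ((1 - l) *: x)) (sqr_normB y) !normrZ dotZl (dotC x (l *:
  y)) dotZl.
by rewrite !exprMn !real_normK ?num_real //; ring.
Qed.

End InnerProduct.

Section BorelMeasurability.
Context (R : realType) (H : completeNormedModType R) (sepH : separable H).
Notation HB := (g_sigma_algebraType (@open H)).
Context (d : measure_display) (X : measurableType d).

Lemma open_borel (U : set H) : open U -> measurable (U : set HB).
Proof. by move=> oU; apply: sub_sigma_algebra. Qed.

Lemma borel_preimage (f : X -> H) (U : set H) : borel_measurable f ->
  open U -> measurable (f @^-1` U).
Proof. by move=> mf oU; rewrite -[_ @^-1` _]setTI; apply: mf => //;
  exact: open_borel. Qed.

Lemma dense_seqP : exists q : nat -> H, forall (x : H) (e : R),
  0 < e -> exists n, `|x - q n| < e.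
Proof.
have [A cA dA] := sepH.
have A0 : A !=set0.
  have [|x [_ Ax]] := dA setT _ openT; last by exists x.
  by exists 0.
have [q qA] : exists q : nat -> H, A `<=` range q.
  have /pfcard_geP[A0'|[q]] := cA.
    by case: A0 => x; rewrite A0'.
  exists q => x Ax.
  have [y _ <-] := (@surj _ _ _ _ q) x Ax; by exists y.
exists q => x e e0.
have [|y [xy Ay]] := dA (ball x e) _ (@ball_open _ _ x e).
  by exists x; exact: ballxx.
have [n _ qn] := qA _ Ay.
by exists n; rewrite qn; move: xy; rewrite -ball_normE.
Qed.

Lemma continuous_borel_measurable (f : X -> H) (g : H -> R) :
  borel_measurable f -> continuous g -> measurable_fun setT (g \o f).
Proof.
move=> mf /continuousP cg; apply: (measurability _ (RGenOpens.measurableE R)).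
move=> _ [_ [a [b ->] <-]]; rewrite setTI comp_preimage.
by apply: borel_preimage => //; apply: cg; exact: interval_open.
Qed.

Lemma borel_measurable_norm (f : X -> H) (c : H) :
  borel_measurable f -> measurable_fun setT (fun w => `|f w - c|).
Proof.
move=> mf; apply: (continuous_borel_measurable (g := fun x => `|x - c|) mf).
move=> x; apply: cvg_norm; apply: cvgB; [exact: cvg_id|exact: cvg_cst].
Qed.

(** By separability an open set is a countable union of balls with centres [q n] and radii
    [1 / (m + 1)], so Borel measurability reduces to that of real functions. *)
Lemma borel_measurableP (f : X -> H) :
  (forall c, measurable_fun setT (fun w => `|f w - c|)) -> borel_measurable f.
Proof.
move=> mf; have [q qP] := dense_seqP.
apply: (@measurability _ _ X HB setT f (@open H) erefl).
move=> _ [U oU <-]; rewrite setTI.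
pose I := [set nm : nat * nat | ball (q nm.1) (nm.2.+1%:R^-1 : R) `<=` U].
have -> : f @^-1` U = \bigcup_(nm in I) [set w | `|f w - q nm.1| < nm.2.+1%:R^-1].
  apply/seteqP; split=> [w /= Ufw|w /= [nm] Inm /= fw].
    have /nbhs_ballP[e /= e0 eU] := open_nbhs_nbhs (conj oU Ufw).
    have [m _ /(_ _ (leqnn m)) /= me] := near_infty_natSinv_lt (PosNum
      (divr_gt0 e0 (ltr0n R 2))).
    have [|n fn] := qP (f w) m.+1%:R^-1; first by rewrite invr_gt0.
    exists (n, m) => //= y; rewrite -ball_normE /= => qy; apply: eU.
    rewrite -ball_normE /= -(subrKA (q n)) (le_lt_trans (ler_normD _ _)) //.
    have -> : e = e / 2 + e / 2 by field.
    by apply: ltrD; [apply: lt_trans fn me|apply: lt_trans qy me].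
  by apply: Inm; rewrite -ball_normE /= distrC.
rewrite bigcup_mkcond; apply: countable_bigcupT_measurable;
  first exact: countableP.
move=> nm; case: ifP => _; last exact: measurable0.
have := mf (q nm.1) measurableT _ (measurable_itv `]-oo, (nm.2.+1%:R^-1 : R)[).
rewrite setTI; congr (measurable _).
Qed.
End BorelMeasurability.

(** * Measurability jointly in the point and the sample *)

Section JointMeasurability.
Context (R : realType) (H : completeNormedModType R) (sepH : separable H).
Notation HB := (g_sigma_algebraType (@open H)).
(* A nonexpansive function is the infimal convolution of its restriction to a
   dense sequence with the norm, which turns joint measurability into a countable
   infimum. *)
Lemma lipschitz_joint_measurable d (X : measurableType d)
    (g : H -> X -> R) :
  (forall s x y, `|g x s - g y s| <= `|x - y|) ->
  (forall x, measurable_fun setT (g x)) ->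
  measurable_fun setT (fun z : HB * X => g z.1 z.2).
Proof.
move=> g1 mg; have [q qP] := dense_seqP sepH.
have gle (z : HB * X) n : g z.1 z.2 <= g (q n) z.2 + `|(z.1 : H) - q n|.
  have := le_trans (ler_norm _) (g1 z.2 z.1 (q n)).
  by rewrite lerBlDl.
have -> : (fun z : HB * X => g z.1 z.2) =
    (fun z => infs (fun n => g (q n) z.2 + `|(z.1 : H) - q n|) 0).
  apply/funext => z; apply/eqP; rewrite eq_le; apply/andP; split.
    apply: lb_le_inf; first by exists (g (q 0%N) z.2 + `|(z.1 : H) - q 0%N|), 0%N.
    by move=> _ [n _ <-].
  apply/ler_addgt0Pr => e e0.
  have [n ne] := qP z.1 (e / 2) (divr_gt0 e0 (ltr0n R 2)).
  have lb : has_lbound (sdrop (fun n => g (q n) z.2 + `|(z.1 : H) - q n|) 0).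
    by exists (g z.1 z.2) => _ [m _ <-].
  apply: (le_trans (ge_inf lb _)); first by exists n.
  have := le_trans (ler_norm _) (g1 z.2 (q n) z.1).
  rewrite distrC lerBlDl => gq.
  rewrite (le_trans (lerD gq (lexx _))) // -addrA lerD2l.
  have -> : e = e / 2 + e / 2 by field.
  by rewrite lerD // ltW.
apply: measurable_fun_infs => [z _|n].
  by exists (g z.1 z.2) => _ [m _ <-].
apply: measurable_funD.
  exact: (measurableT_comp (mg _) measurable_snd).
apply: (@borel_measurable_norm _ _ _ (HB * X)%type fst).
exact: measurable_fst.
Qed.

Context (d : measure_display) (X : measurableType d).

(** Each [|U x s - c|] is again 1-Lipschitz in [x], so the scalar statement applies to it. Tonelli
    for the pair (iterate, sample) rests on this. *)
Lemma nonexpansive_joint_measurable (U : H -> X -> H) :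
  (forall s x y, `|U x s - U y s| <= `|x - y|) ->
  (forall x, borel_measurable (U x)) ->
  @borel_measurable R _ (HB * X)%type H (fun z => U z.1 z.2).
Proof.
move=> U1 mU; apply: borel_measurableP => // c.
apply: (@lipschitz_joint_measurable _ X (fun x s => `|U x s - c|)) => [s x y|x].
  rewrite (le_trans (ler_dist_dist _ _)) //.
  by rewrite opprB addrA subrK.
exact: borel_measurable_norm.
Qed.

(** The pair of maps is measurable for the product of the two Borel sigma-algebras, whereas
    continuity of the distance concerns the product topology; the Lipschitz argument works with the
    product sigma-algebra directly. *)
Lemma borel_measurable_dist (f g : X -> H) : borel_measurable f ->
  borel_measurable g -> measurable_fun setT (fun w => `|f w - g w|).
Proof.
move=> mf mg.
have m := @lipschitz_joint_measurable _ HB (fun x y => `|x - (y : H)|).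
apply: (measurableT_comp (f := fun z : HB * HB => `|(z.1 : H) - z.2|)
  (g := fun w => (f w : HB, g w : HB))).
  apply: m => [s x y|x].
    rewrite (le_trans (ler_dist_dist _ _)) //.
    by rewrite opprB addrA subrK.
  under eq_fun do rewrite distrC.
  by apply: (@borel_measurable_norm _ _ _ HB id); exact: measurable_id.
exact: measurable_fun_pair.
Qed.
End JointMeasurability.

(** * Bochner integral *)

Section SimpleFunctions.
Context (R : realType) (H : completeNormedModType R) (dot : {dot H for idfun})
        (norm_dot : forall x : H, dot x x = `|x| ^+ 2).
Context (d : measure_display) (X : measurableType d) (mu : probability X R).
Implicit Types (f s : X -> H) (h : H).

Lemma measurable_dot f h : borel_measurable f ->
  measurable_fun setT (fun w => dot (f w) h).
Proof.
move=> mf.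
have -> : (fun w => dot (f w) h) =
    (fun w => (`|f w - (- h)| ^+ 2 - `|f w - 0| ^+ 2 - `|h| ^+ 2) / 2).
  by apply/funext => w; rewrite (polarization norm_dot) opprK subr0.
apply: measurable_funM => //; apply: measurable_funB => //.
by apply: measurable_funB; apply: measurable_funX; exact: borel_measurable_norm.
Qed.

Lemma simple_function_fiber s v : simple_function s -> measurable (s @^-1` [set
  v]).
Proof.
move=> [ms _]; rewrite -[_ @^-1` _]setCK preimage_setC.
apply: measurableC; apply: borel_preimage => //.
apply: closed_openC; apply: accessible_closed_set1; apply: hausdorff_accessible.
exact: norm_hausdorff.
Qed.

Lemma simple_function_dot_integral s h : simple_function s ->
  mu.-integrable setT (fun w => (dot (s w) h)%:E) /\
  (\int[mu]_w (dot (s w) h)%:E)%E = (dot (simple_integral mu s) h)%:E.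
Proof.
move=> ss; have [ms fs] := ss.
pose A v := s @^-1` [set v].
have mA v : measurable (A v) by exact: simple_function_fiber.
have E : (fun w => (dot (s w) h)%:E) =
    (fun w => \sum_(v <- fset_set (range s)) ((dot v h)%:E * (\1_(A v)
      w)%:E)%E)%E.
  apply/funext => w; rewrite (big_fsetD1 (s w)) /=; last first.
    by rewrite in_fset_set // inE; exists w.
  rewrite indicE mem_set // mule1 big_seq big1 ?adde0 // => v.
  rewrite !inE => /andP[/eqP vw _].
  by rewrite indicE memNset ?mule0 // /A => /= /esym.
have iI v : mu.-integrable setT (fun w => ((dot v h)%:E * (\1_(A v) w)%:E)%E).
  apply: integrableZl => //; exact: integrable_indic.
split; first by rewrite E; apply: integrable_sum.
rewrite E integral_sum //.
rewrite /simple_integral fsbig_finite //.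
have -> : dot (\sum_(v <- fset_set (range s)) fine (mu (A v)) *: v) h =
    \sum_(v <- fset_set (range s)) fine (mu (A v)) * dot v h.
  elim/big_rec2: _ => [|v y1 y2 _ <-].
    by rewrite -(scale0r 0) dotZl mul0r.
  by rewrite dotDl dotZl.
rewrite -sumEFin; apply: eq_bigr => v _.
rewrite integralZl //; last first.
  exact: integrable_indic.
by rewrite integral_indic // setIT muleC EFinM fineK // fin_num_measure.
Qed.

Lemma simple_function_integrable_norm s : simple_function s ->
  mu.-integrable setT (fun w => (`|s w|)%:E).
Proof.
move=> [ms fs]; apply: measurable_bounded_integrable => //.
- by apply: le_lt_trans (probability_le1 mu measurableT) _; exact: ltry.
- by have := borel_measurable_norm 0 ms; under eq_fun do rewrite subr0.
- have [M HM] : exists M, forall w, `|s w| <= M.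
    exists (\sum_(v <- fset_set (range s)) `|v|) => w.
    rewrite (big_fsetD1 (s w)) /=; last by rewrite in_fset_set // inE; exists w.
    by rewrite lerDl sumr_ge0.
  exists M; split; first exact: num_real.
  move=> y My w _ /=; rewrite ger0_norm //.
  exact: le_trans (HM w) (ltW My).
Qed.
End SimpleFunctions.

Section BochnerWeak.
Context (R : realType) (H : completeNormedModType R) (dot : {dot H for idfun})
        (norm_dot : forall x : H, dot x x = `|x| ^+ 2) (sepH : separable H).
Context (d : measure_display) (X : measurableType d) (mu : probability X R).
Implicit Types (f : X -> H) (h : H).

Lemma integrable_dot f h : borel_measurable f ->
  mu.-integrable setT (fun w => (`|f w|)%:E) ->
  mu.-integrable setT (EFin \o (fun w => dot (f w) h)).
Proof.
move=> mf fi.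
apply: (le_integrable measurableT _ _ (integrableZr measurableT `|h| fi)).
  by apply/measurable_EFinP; exact: measurable_dot.
move=> w _ /=; rewrite lee_fin [leRHS]ger0_norm ?mulr_ge0 //.
exact: norm_dot_le.
Qed.

Lemma bochner_approx_integrable f s : borel_measurable f ->
  bochner_approx mu f s -> mu.-integrable setT (fun w => (`|f w|)%:E).
Proof.
(* Convergence to 0 in the extended reals makes the integral of [|f - s N|] finite for some [N];
   [|f|] is then dominated by [|f - s N| + |s N|]. *)
move=> mf [ss /fine_cvgP[[N _ /(_ N (leqnn N)) /= fN] _]].
have ms : borel_measurable (s N) by case: (ss N).
have i1 : mu.-integrable setT (fun w => (`|f w - s N w|)%:E).
  apply/integrableP; split.
    by apply/measurable_EFinP; exact: borel_measurable_dist.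
  under eq_integral do rewrite gee0_abs ?lee_fin //.
  by rewrite ltey_eq fN.
have := integrableD measurableT i1 (simple_function_integrable_norm mu (ss N)).
apply: le_integrable => //.
  apply/measurable_EFinP.
  by have := borel_measurable_norm 0 mf; under eq_fun do rewrite subr0.
move=> w _ /=; rewrite lee_fin normr_id [leRHS]ger0_norm ?addr_ge0 //.
by rewrite -{1}(subrK (s N w) (f w)) ler_normD.
Qed.

(** This quantitative weak estimate yields both the Cauchy property of the approximating integrals
    and the value of their limit. *)
Lemma bochner_approx_dot f s n h : borel_measurable f -> bochner_approx mu f s ->
  `|dot (simple_integral mu (s n)) h - \int[mu]_w dot (f w) h| <=
  fine (\int[mu]_w (`|f w - s n w|)%:E)%E * `|h|.
Proof.
move=> mf fs; have [/(_ n) ss _] := fs; have [ms _] := ss.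
have fi := bochner_approx_integrable mf fs.
have i1 : mu.-integrable setT (EFin \o (fun w => `|f w - s n w|)).
  apply: (le_integrable measurableT _ _
    (integrableD measurableT fi (simple_function_integrable_norm mu ss))).
    by apply/measurable_EFinP; exact: borel_measurable_dist.
  move=> w _ /=; rewrite lee_fin normr_id [leRHS]ger0_norm ?addr_ge0 //.
  exact: ler_normB.
have [i2 E] := simple_function_dot_integral dot mu h ss.
have i3 := integrable_dot h mf fi.
have -> : dot (simple_integral mu (s n)) h = \int[mu]_w dot (s n w) h.
  by rewrite /Rintegral E.
rewrite -RintegralB //.
have i4 := integrableB measurableT i2 i3.
apply: le_trans (le_normr_Rintegral measurableT i4) _.
rewrite -[fine _]/(Rintegral _ _ _) -RintegralZr //.
apply: le_Rintegral => //.
- exact: integrable_norm.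
- exact: (integrableZr measurableT `|h| i1).
- move=> w _; rewrite -(dotBl dot) distrC; exact: norm_dot_le.
Qed.

Lemma bochner_integral_dot f h : borel_measurable f -> bochner_integrable mu f ->
  dot (bochner_integral mu f) h = \int[mu]_w dot (f w) h.
Proof.
move=> mf [s fs].
(* All approximating sequences are treated at once, because the [get] in [bochner_integral] may
   select a limit produced by a sequence other than [s]. *)
have dotN (s' : nat -> X -> H) : bochner_approx mu f s' -> forall v,
    (fun n => simple_integral mu (s' n)) @ \oo --> v ->
    dot v h = \int[mu]_w dot (f w) h.
  move=> fs' v vs; apply/eqP; rewrite -subr_eq0 -normr_le0.
  have /fine_cvgP[_ /= c0] := fs'.2.
  have c1 : (fun n => `|v - simple_integral mu (s' n)| * `|h| +
      fine (\int[mu]_w (`|f w - s' n w|)%:E)%E * `|h|) @ \oo --> (0 : R).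
    rewrite -(addr0 0) -{1}(mul0r `|h|) -{2}(mul0r `|h|).
    apply: cvgD; apply: cvgM; (try exact: cvg_cst) => //.
    rewrite -(normr0 H) -(subrr v); apply: cvg_norm; apply: cvgB => //.
    exact: cvg_cst.
  apply: (cvgr_to_ge c1); apply: nearW => n.
  rewrite -(subrKA (dot (simple_integral mu (s' n)) h)).
  rewrite (le_trans (ler_normD _ _)) // lerD //; last exact: bochner_approx_dot.
  by rewrite -(dotBl dot); exact: norm_dot_le.
(* Existence of a limit must be shown too, otherwise [get] could return its default value. *)
suff [v vs] : exists v : H, (fun n => simple_integral mu (s n)) @ \oo --> v.
  have /getPex[s' fs' vs'] : exists v : H, exists2 s, bochner_approx mu f s &
     (fun n => simple_integral mu (s n)) @ \oo --> v by exists v, s.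
  exact: dotN fs' _ vs'.
suff /cauchy_cvgP /cvg_ex[v vs] : cauchy ((fun n => simple_integral mu (s n)) @
  \oo).
  by exists v.
apply/cauchyP => e e0.
have /fine_cvgP[_ /= c0] := fs.2.
have /cvgrPdist_lt /(_ (e / 2)) := c0.
case; first by rewrite divr_gt0.
move=> N _ HN; exists (simple_integral mu (s N)).
exists N => // n /= Nn; rewrite -ball_normE /=.
have [->|nz] := eqVneq (simple_integral mu (s N)) (simple_integral mu (s n)).
  by rewrite subrr normr0.
(* The difference is tested against itself: the weak estimates give [|u|^2 = dot u u < e |u|], hence
   strong smallness. *)
set u := _ - _.
have u0 : 0 < `|u| by rewrite normr_gt0 subr_eq0.
have b m : (N <= m)%N -> `|dot (simple_integral mu (s m)) u -
    \int[mu]_w dot (f w) u| < e / 2 * `|u|.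
  move=> Nm; apply: le_lt_trans (bochner_approx_dot _ _ mf fs) _.
  rewrite ltr_pM2r //; apply: le_lt_trans (ler_norm _) _.
  by have := HN m Nm; rewrite sub0r normrN.
have : `|u| ^+ 2 < e * `|u|.
  rewrite -norm_dot {1}/u (dotBl dot).
  apply: le_lt_trans (ler_norm _) _.
  rewrite -(subrKA (\int[mu]_w dot (f w) u)).
  apply: le_lt_trans (ler_normD _ _) _.
  have -> : e * `|u| = e / 2 * `|u| + e / 2 * `|u| by field.
  by rewrite ltrD ?b // distrC b.
by rewrite expr2 ltr_pM2r.
Qed.

End BochnerWeak.

(** * Independence of the samples *)

Lemma bigcap_fsetU1T (I : choiceType) (U : Type) (F : I -> set U) (x : I) (X :
  {fset I}) :
  \bigcap_(i in [set` (x |` X)%fset]) F i = F x `&` \bigcap_(i in [set` X]) F i.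
Proof.
apply/seteqP; split=> [y h|y [yx h] i /=].
  by split=> [|i /= iX]; apply: h => /=; rewrite !inE ?eqxx ?iX ?orbT.
by rewrite !inE => /orP[/eqP->|] //; exact: h.
Qed.

Section Fresh.
Context (R : realType) (dO dX : measure_display) (Omega : measurableType dO)
        (Xi : measurableType dX) (P : probability Omega R) (D : probability Xi R)
        (xi : nat -> {RV P >-> Xi}) (iid : iid_from D xi).

(* Y belongs to the past of time k. Independence of the later samples, rather than
   measurability for a filtration, is what propagates along Y' = U (Y, xi k). *)
Definition fresh (k : nat) dS (S : measurableType dS) (Y : Omega -> S) :=
  measurable_fun setT Y /\
  forall A (J : {fset nat}) (B : nat -> set Xi), measurable A ->
    (forall j, j \in J -> (k <= j)%N) -> (forall j, measurable (B j)) ->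
    P (Y @^-1` A `&` \bigcap_(j in [set` J]) xi j @^-1` B j) =
    (P (Y @^-1` A) * \prod_(j <- J) D (B j))%E.

Lemma measurable_sample k (B : set Xi) : measurable B -> measurable (xi k @^-1`
  B).
Proof. by move=> mB; rewrite -[X in measurable X]setTI;
  exact: (measurable_funPT (xi k)). Qed.

Lemma measurable_samples (J : {fset nat}) (B : nat -> set Xi) :
  (forall j, measurable (B j)) ->
  measurable (\bigcap_(j in [set` J]) xi j @^-1` B j).
Proof.
move=> mB; apply: fin_bigcap_measurable => // j _; exact: measurable_sample.
Qed.

Lemma fresh_cst k dS (S : measurableType dS) (c : S) : fresh k (fun _ : Omega
  => c).
Proof.
split; first exact: measurable_cst.
move=> A J B mA _ mB.
have E : P (\bigcap_(j in [set` J]) xi j @^-1` B j) = (\prod_(j <- J) D (B j))%E.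
  have [law ind] := iid.
  by rewrite ind //; apply: eq_bigr => j _; rewrite -(law j).
have [Ac|nAc] := pselect (A c).
  rewrite (_ : _ @^-1` A = setT); last by apply/seteqP; split.
  by rewrite setTI E probability_setT mul1e.
rewrite (_ : _ @^-1` A = set0); last by apply/seteqP; split.
by rewrite set0I measure0 mul0e.
Qed.

Lemma fresh_comp k dS (S : measurableType dS) dS' (S' : measurableType dS')
    (Y : Omega -> S) (F : S -> S') :
  measurable_fun setT F -> fresh k Y -> fresh k (F \o Y).
Proof.
move=> mF [mY fY]; split; first exact: measurableT_comp.
move=> A J B mA Jk mB; rewrite comp_preimage; apply: fY => //.
by rewrite -[X in measurable X]setTI; exact: mF.
Qed.

Section Step.
Context (k : nat) (dS : measure_display) (S : measurableType dS) (Y : Omega -> S)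
        (fY : fresh k Y).

Let Z w := (Y w, xi k w).

Let mZ : measurable_fun setT Z.
Proof. by apply: measurable_fun_pair; [by case: fY|exact: measurable_funPT]. Qed.

Let rect A B (J : {fset nat}) (C : nat -> set Xi) : measurable A -> measurable
  B ->
  (forall j, j \in J -> (k < j)%N) -> (forall j, measurable (C j)) ->
  P (Z @^-1` (A `*` B) `&` \bigcap_(j in [set` J]) xi j @^-1` C j) =
  (P (Y @^-1` A) * D B * \prod_(j <- J) D (C j))%E.
Proof.
move=> mA mB Jk mC.
have kJ : k \notin J by apply/negP => /Jk; rewrite ltnn.
(* [C'] places [B] in slot [k], so the event for [xi k] is absorbed into the later samples and
   freshness of [Y] applies to [J] enlarged by [k]. *)
pose C' j := if j == k then B else C j.
have [_ fYr] := fY.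
transitivity (P (Y @^-1` A `&`
    \bigcap_(j in [set` (k |` J)%fset]) xi j @^-1` C' j)).
  rewrite bigcap_fsetU1T setIA {1}/C' eqxx; congr (P (_ `&` _)).
  apply: eq_bigcapr => j /= jJ; rewrite /C'.
  by have [jk|//] := eqVneq j k; rewrite -jk jJ in kJ.
rewrite fYr //.
- rewrite big_fsetU1 //= {1}/C' eqxx muleA; congr (_ * _)%E.
  rewrite !big_seq; apply: eq_bigr => j jJ; rewrite /C'.
  by have [jk|//] := eqVneq j k; rewrite -jk jJ in kJ.
- by move=> j; rewrite !inE => /orP[/eqP->//|/Jk /ltnW].
- by move=> j; rewrite /C'; case: ifP.
Qed.

Let Zm : {mfun Omega >-> (S * Xi)%type} :=
  HB.pack Z (isMeasurableFun.Build _ _ _ _ Z mZ).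

Let Ym : {mfun Omega >-> S} :=
  HB.pack Y (isMeasurableFun.Build _ _ _ _ Y (proj1 fY)).

Let measure_rect_unique (m1 m2 : {measure set (S * Xi)%type -> \bar R}) :
  (m1 setT < +oo)%E ->
  (forall A B, measurable A -> measurable B -> m1 (A `*` B) = m2 (A `*` B)) ->
  forall E, measurable E -> m1 E = m2 E.
Proof.
move=> fin eqr; apply: (@measure_unique _ _ _
  [set A `*` B | A in measurable & B in measurable] (fun _ => setT)).
- exact: measurable_prod_measurableType.
- move=> _ _ [A mA [B mB <-]] [A' mA' [B' mB' <-]].
  exists (A `&` A'); first exact: measurableI.
  by exists (B `&` B'); [exact: measurableI|rewrite setXI].
- by move=> _; exists setT => //; exists setT => //; rewrite setXTT.
- by rewrite bigcup_const //; exists 0%N.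
- by move=> _ [A mA [B mB <-]]; exact: eqr.
- by [].
Qed.

(** As functions of [E], both sides are finite measures: the law of [Z] restricted to the event of
    the later samples, and a multiple of the law of [Z]. They agree on rectangles, which form a
    generating pi-system. *)
Lemma fresh_step_law (J : {fset nat}) (C : nat -> set Xi) (E : set (S * Xi)) :
  (forall j, j \in J -> (k < j)%N) -> (forall j, measurable (C j)) ->
  measurable E ->
  P (Z @^-1` E `&` \bigcap_(j in [set` J]) xi j @^-1` C j) =
  (P (Z @^-1` E) * \prod_(j <- J) D (C j))%E.
Proof.
move=> Jk mC.
set c := (\prod_(j <- J) D (C j))%E.
have c_fin : c \is a fin_num.
  by rewrite /c; apply: prode_fin_num => j _; rewrite fin_num_measure.
have c0 : 0 <= fine c.
  by apply: fine_ge0; rewrite /c; apply: prode_ge0 => j _.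
pose m1 := measure_function_pushforward__canonical__measure_function_Measure
  (mrestr P (measurable_samples J mC)) mZ.
pose m2 : {measure set (S * Xi)%type -> \bar R} :=
  mscale (NngNum c0) (distribution P Zm).
move=> mE.
transitivity (m2 E); last by rewrite /m2 /= /mscale /= fineK // muleC.
apply: (measure_rect_unique (m1 := m1)) => //.
  rewrite (le_lt_trans (probability_le1 _ _)) ?ltry //.
  by rewrite preimage_setT setTI; exact: measurable_samples.
move=> A B mA mB; rewrite /m2 /= /mscale /= fineK //.
transitivity (P (Y @^-1` A) * D B * c)%E; first exact: rect.
rewrite muleC; congr (_ * _)%E.
(* With no later sample, [rect] says that [Z] has a product law on rectangles. *)
have no j : j \in fset0 -> (k < j)%N by rewrite inE.
have := rect mA mB no mC; rewrite big_seq_fset0 mule1 set_fset0.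
by rewrite bigcap_set0 setIT => /esym.
Qed.

(** Substitute for conditioning on the past: the joint law of [Y] and [xi k] is the product of the
    law of [Y] with [D], and Tonelli integrates the sample first. *)
Lemma fresh_law (f : S * Xi -> \bar R) : measurable_fun setT f ->
  (forall z, 0 <= f z)%E ->
  (\int[P]_w f (Y w, xi k w) = \int[P]_w \int[D]_s f (Y w, s))%E.
Proof.
move=> mf f0.
transitivity (\int[distribution P Zm]_z f z)%E.
  by rewrite ge0_integral_distribution.
transitivity (\int[(distribution P Ym \x D)%E]_z f z)%E.
  apply: eq_measure_integral => E mE _.
  apply: esym; apply: product_measure_unique => // A B mA mB.
  have no j : j \in fset0 -> (k < j)%N by rewrite inE.
  have := rect mA mB no (fun _ => measurableT).
  rewrite big_seq_fset0 mule1 set_fset0.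
  by rewrite bigcap_set0 setIT.
rewrite fubini_tonelli1 // ge0_integral_distribution //.
  exact: measurable_fun_fubini_tonelli_F.
by move=> y; apply: integral_ge0.
Qed.

Lemma fresh_step dS' (S' : measurableType dS') (U : S * Xi -> S') :
  measurable_fun setT U -> fresh k.+1 (fun w => U (Y w, xi k w)).
Proof.
move=> mU; split; first exact: (measurableT_comp mU mZ).
move=> A J B mA Jk mB.
have := @fresh_step_law J B (U @^-1` A) Jk mB.
apply.
by rewrite -[X in measurable X]setTI; exact: mU.
Qed.
End Step.
End Fresh.

(** * One step of the algorithm *)

Section OneStep.
Context (R : realType) (H : completeNormedModType R) (dot : {dot H for idfun})
        (norm_dot : forall x : H, dot x x = `|x| ^+ 2) (sepH : separable H).
Context (dX : measure_display) (Xi : measurableType dX) (D : probability Xi R).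
Context (S : Xi -> H -> H) (S1 : forall s, nonexpansive (S s))
        (mS : forall x, borel_measurable (fun s => S s x))
        (iS : forall x, D.-integrable setT (fun s => (`|S s x|)%:E))
        (M : H -> H) (MS : forall x h, dot (M x) h = \int[D]_s dot (S s x) h).

(** Only the weak form of the mean is used: test with [h = M x - M y], bound the integrand by
    Cauchy-Schwarz, and divide by [|h|]. *)
Lemma nonexpansive_mean : nonexpansive M.
Proof.
move=> x y; have [->|xy] := eqVneq (M x) (M y); first by rewrite subrr normr0.
have Mxy : 0 < `|M x - M y| by rewrite normr_gt0 subr_eq0.
rewrite -(ler_pM2r Mxy) -expr2 -norm_dot (dotBl dot) !MS.
have ix z := integrable_dot norm_dot (M x - M y) (mS z) (iS z).
rewrite -RintegralB //.
have ixy := integrableB measurableT (ix x) (ix y).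
have icst : D.-integrable setT (EFin \o cst (`|x - y| * `|M x - M y|)).
  exact: finite_measure_integrable_cst.
apply: le_trans (le_Rintegral measurableT ixy icst _) _.
  move=> s _ /=; rewrite -(dotBl dot) (le_trans (dot_le norm_dot _ _)) //.
  by rewrite ler_wpM2r ?S1.
by rewrite Rintegral_cst // [X in fine X](probability_setT D) mulr1.
Qed.

Definition defect x := `|M x - x|.

Lemma defect_ge0 x : 0 <= defect x.
Proof. exact: normr_ge0. Qed.

Definition relaxed l x := (1 - l) *: x + l *: M x.

Lemma relaxed_nonexpansive l : 0 <= l -> l <= 1 -> nonexpansive (relaxed l).
Proof.
move=> l0 l1 x y; rewrite /relaxed opprD addrACA -!scalerBr.
rewrite (le_trans (ler_normD _ _)) // !normrZ !ger0_norm ?subr_ge0 //.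
have := ler_wpM2l l0 (nonexpansive_mean x y); lra.
Qed.

(** With [z'] the relaxed point, [M z' - z' = (M z' - M z) + (M z - z')]; the two parts have norm at
    most [l] and [1 - l] times the defect of [z]. *)
Lemma defect_relaxed l z : 0 <= l -> l <= 1 -> defect (relaxed l z) <= defect z.
Proof.
move=> l0 l1; rewrite /defect.
have E1 : relaxed l z - z = l *: (M z - z).
  by rewrite /relaxed scalerBl scale1r addrAC [z - _]addrC addrK addrC scalerBr.
have E2 : M z - relaxed l z = (1 - l) *: (M z - z).
  by rewrite -(subrKA z) -[z - _]opprB E1 scalerBl scale1r.
rewrite -(subrKA (M z)) (le_trans (ler_normD _ _)) // E2.
rewrite (le_trans (lerD (nonexpansive_mean _ _) (lexx _))) // E1.
by rewrite !normrZ !ger0_norm ?subr_ge0 // -mulrDl addrC subrK mul1r.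
Qed.

Lemma defect_lip x z : defect x <= defect z + 2 * `|x - z|.
Proof.
rewrite /defect -lerBlDl.
rewrite (le_trans (lerB_dist _ _)) //.
have -> : M x - x - (M z - z) = (M x - M z) - (x - z).
  by rewrite !opprB addrACA [RHS]addrACA [- x - _]addrC.
rewrite (le_trans (ler_normB _ _)) // mulr_natl mulr2n lerD2r.
exact: nonexpansive_mean.
Qed.

Context (p : H) (Mp : M p = p) (sigma : R)
        (varp : (\int[D]_s (`|S s p - M p| ^+ 2)%:E <= (sigma ^+ 2)%:E)%E).

Lemma measurable_sqr_noise x c :
  measurable_fun setT (fun s => (`|S s x - c| ^+ 2)%:E).
Proof.
by apply/measurable_EFinP; apply: measurable_funX; exact: borel_measurable_norm.
Qed.

(* The plain triangle inequality gives the factor 8 where the paper has 2; the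
   rates are not affected. *)
Definition noise_bound x := 8 * `|x - p| ^+ 2 + 2 * sigma ^+ 2.

Lemma noise_variance x :
  (\int[D]_s (`|S s x - M x| ^+ 2)%:E <= (noise_bound x)%:E)%E.
Proof.
apply: (@le_trans _ _ (\int[D]_s ((8 * `|x - p| ^+ 2)%:E +
    2%:E * (`|S s p - M p| ^+ 2)%:E))%E).
  apply: ge0_le_integral => //.
  - exact: measurable_sqr_noise.
  - by apply: emeasurable_funD => //; apply: emeasurable_funM => //;
      exact: measurable_sqr_noise.
  - move=> s _; rewrite -EFinM -EFinD lee_fin.
    have h : `|S s x - M x| <= 2 * `|x - p| + `|S s p - M p|.
      have -> : S s x - M x = (S s x - S s p) + ((S s p - M p) - (M x - M p)).
        by rewrite opprB !subrKA.
      have := ler_normD (S s x - S s p) ((S s p - M p) - (M x - M p)).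
      have := ler_normB (S s p - M p) (M x - M p).
      have := S1 s x p; have := nonexpansive_mean x p; lra.
    have h2 : `|S s x - M x| ^+ 2 <= (2 * `|x - p| + `|S s p - M p|) ^+ 2.
      by rewrite lerXn2r ?nnegrE ?addr_ge0 ?mulr_ge0.
    (* This is [(u + v)^2 <= 2 u^2 + 2 v^2] with [u = 2 |x - p|], whence the constants 8 and 2. *)
    have := sqr_ge0 (2 * `|x - p| - `|S s p - M p|); nra.
rewrite ge0_integralD //; last by apply: emeasurable_funM => //;
  exact: measurable_sqr_noise.
rewrite integral_cst // [X in (_ * X)%E](probability_setT D) mule1
  ge0_integralZl //; last exact: measurable_sqr_noise.
by rewrite /noise_bound [leRHS]EFinD; apply: leeD2l; rewrite [leRHS]EFinM;
  apply: lee_wpmul2l; rewrite ?lee_fin.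
Qed.

Lemma mean_noise_shift x c l :
  (\int[D]_s (`|c + l *: (S s x - M x)| ^+ 2)%:E <=
   (`|c| ^+ 2 + l ^+ 2 * noise_bound x)%:E)%E.
Proof.
have i2 : D.-integrable setT (fun s => (`|S s x - M x| ^+ 2)%:E).
  apply/integrableP; split; first exact: measurable_sqr_noise.
  under eq_integral do rewrite gee0_abs ?lee_fin ?sqr_ge0 //.
  by rewrite (le_lt_trans (noise_variance x)) // ltry.
have i1 := integrable_dot norm_dot c (mS x) (iS x).
have icst r : D.-integrable setT (EFin \o cst r) by exact:
  finite_measure_integrable_cst.
have i1' : D.-integrable setT (EFin \o (fun s => dot (S s x - M x) c)).
  have := integrableB measurableT i1 (icst (dot (M x) c)).
  by congr (integrable _ _ _); apply/funext => s /=; rewrite (dotBl dot).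
have -> : (\int[D]_s (`|c + l *: (S s x - M x)| ^+ 2)%:E =
    \int[D]_s ((`|c| ^+ 2)%:E + ((2 * l)%:E * (dot (S s x - M x) c)%:E
      + (l ^+ 2)%:E * (`|S s x - M x| ^+ 2)%:E)))%E.
  apply: eq_integral => s _; rewrite -!EFinM -!EFinD; congr EFin.
  rewrite (sqr_normD norm_dot c) (dotC dot c) (dotZl dot) normrZ exprMn.
  by rewrite real_normK ?num_real //; ring.
rewrite integralD //; [|exact: icst|]; last first.
  by apply: integrableD => //; apply: integrableZl.
rewrite integralD //; [|exact: integrableZl|exact: integrableZl].
rewrite integral_cst // [X in (_ * X)%E](probability_setT D) mule1 !integralZl //.
have -> : (\int[D]_s (dot (S s x - M x) c)%:E = 0)%E.
  under eq_integral do rewrite (dotBl dot) EFinB.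
  rewrite integralB //; last exact: (icst (dot (M x) c)).
  rewrite (integral_cst _ _ (dot (M x) c)%:E) // [X in (_ *
    X)%E](probability_setT D) mule1.
  rewrite MS /Rintegral fineK ?subee //; exact: integrable_fin_num.
rewrite mule0 add0e [leRHS]EFinD; apply: leeD2l; rewrite [leRHS]EFinM;
  apply: lee_wpmul2l.
  by rewrite lee_fin sqr_ge0.
exact: noise_variance.
Qed.

Definition km_step l x s := (1 - l) *: x + l *: S s x.

Lemma km_stepE l x s : km_step l x s = relaxed l x + l *: (S s x - M x).
Proof. by rewrite /km_step /relaxed scalerBr addrA addrAC addrK. Qed.

Lemma km_step_fixed_point l x : 0 <= l -> l <= 1 ->
  (\int[D]_s (`|km_step l x s - p| ^+ 2)%:E + (l * (1 - l) * defect x ^+ 2)%:E <=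
   ((1 + 8 * l ^+ 2) * `|x - p| ^+ 2 + 2 * l ^+ 2 * sigma ^+ 2)%:E)%E.
Proof.
move=> l0 l1.
under eq_integral do rewrite km_stepE addrAC.
apply: le_trans (leeD (mean_noise_shift _ _ _) (lexx _)) _.
rewrite -EFinD lee_fin.
have -> : relaxed l x - p = (1 - l) *: (x - p) + l *: (M x - p).
  rewrite !scalerBr addrACA -opprD -scalerDl subrK scale1r //.
rewrite (sqr_norm_convex norm_dot) /defect.
have -> : M x - p - (x - p) = M x - x by rewrite opprB subrKA.
have h : `|M x - p| ^+ 2 <= `|x - p| ^+ 2.
  by rewrite -{1}Mp lerXn2r ?nnegrE // nonexpansive_mean.
have := ler_wpM2l l0 h.
rewrite /noise_bound; lra.
Qed.

Lemma km_step_relaxed l x z : 0 <= l -> l <= 1 ->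
  (\int[D]_s (`|km_step l x s - relaxed l z| ^+ 2)%:E <=
   (`|x - z| ^+ 2 + l ^+ 2 * noise_bound x)%:E)%E.
Proof.
move=> l0 l1.
under eq_integral do rewrite km_stepE addrAC.
apply: le_trans (mean_noise_shift _ _ _) _.
by rewrite lee_fin lerD2r lerXn2r ?nnegrE // relaxed_nonexpansive.
Qed.

End OneStep.

(** * Moments of the iterates *)

Lemma nonexpansive_borel (R : realType) (H : completeNormedModType R)
    (sepH : separable H) (F : H -> H) : nonexpansive F ->
  @borel_measurable R _ (g_sigma_algebraType (@open H)) H F.
Proof.
move=> F1; apply: borel_measurableP => // c.
apply: (@continuous_borel_measurable _ _ _ (g_sigma_algebraType (@open H)) id
  (fun x => `|F x - c|)); first exact: measurable_id.
move=> x; apply: cvg_norm; apply: cvgB; last exact: cvg_cst.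
apply/cvgrPdist_lt => e e0; near=> y.
apply: le_lt_trans (F1 _ _) _.
near: y; exact: cvgr_dist_lt.
Unshelve. all: by end_near. Qed.

Section Process.
Context (R : realType) (H : completeNormedModType R) (dot : {dot H for idfun})
        (norm_dot : forall x : H, dot x x = `|x| ^+ 2) (sepH : separable H).
Context (dX : measure_display) (Xi : measurableType dX) (D : probability Xi R).
Context (S : Xi -> H -> H) (S1 : forall s, nonexpansive (S s))
        (mS : forall x, borel_measurable (fun s => S s x))
        (iS : forall x, D.-integrable setT (fun s => (`|S s x|)%:E))
        (M : H -> H) (MS : forall x h, dot (M x) h = \int[D]_s dot (S s x) h).
Context (p : H) (Mp : M p = p) (sigma : R)
        (varp : (\int[D]_s (`|S s p - M p| ^+ 2)%:E <= (sigma ^+ 2)%:E)%E).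
Context (dO : measure_display) (Omega : measurableType dO)
        (P : probability Omega R) (xi : nat -> {RV P >-> Xi})
        (iid : iid_from D xi) (x0 : H) (lambda : nat -> R)
        (l0 : forall k, 0 <= lambda k) (l1 : forall k, lambda k <= 1).
Notation HB := (g_sigma_algebraType (@open H)).
Let X k w : H := skm S lambda x0 xi k w.

Let M1 : nonexpansive M.
Proof. exact: (nonexpansive_mean norm_dot S1 mS iS MS). Qed.

Lemma km_step_nonexpansive l s : 0 <= l -> l <= 1 ->
  nonexpansive (fun x => km_step S l x s).
Proof.
move=> h0 h1 x y; rewrite /km_step opprD addrACA -!scalerBr.
rewrite (le_trans (ler_normD _ _)) // !normrZ !ger0_norm ?subr_ge0 //.
have := ler_wpM2l h0 (S1 s x y); lra.
Qed.

Lemma km_step_borel l : 0 <= l -> l <= 1 ->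
  @borel_measurable R _ (HB * Xi)%type H (fun z => km_step S l z.1 z.2).
Proof.
move=> h0 h1; apply: (nonexpansive_joint_measurable sepH) => [s x y|x].
  exact: km_step_nonexpansive.
apply: borel_measurableP => // c.
apply: (continuous_borel_measurable (g := fun y => `|(1 - l) *: x + l *: y -
  c|)) => //.
move=> y; apply: cvg_norm; apply: cvgB; last exact: cvg_cst.
by apply: cvgD; [exact: cvg_cst|apply: cvgZr; exact: cvg_id].
Qed.

Lemma fresh_iterate k : fresh D xi k (X k : Omega -> HB).
Proof.
elim: k => [|k IH]; first exact: fresh_cst.
exact: (fresh_step IH (km_step_borel (l0 k) (l1 k))).
Qed.

Let measurable_iterate k : measurable_fun setT (X k : Omega -> HB).
Proof. by case: (fresh_iterate k). Qed.

Let relaxed_borel l : 0 <= l -> l <= 1 -> @borel_measurable R _ HB H (relaxed M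
  l).
Proof.
move=> h0 h1; apply: (nonexpansive_borel sepH).
exact: (relaxed_nonexpansive norm_dot S1 mS iS MS).
Qed.

Let measurable_sqr_dist c : measurable_fun setT (fun x : HB => (`|(x : H) - c|
  ^+ 2)%:E).
Proof.
apply/measurable_EFinP; apply: measurable_funX.
apply: (@borel_measurable_norm _ _ _ HB id); exact: measurable_id.
Qed.

Lemma measurable_defect : measurable_fun setT (fun x : HB => defect M x).
Proof.
apply: (@borel_measurable_dist _ _ sepH _ HB M id); last exact: measurable_id.
exact: nonexpansive_borel.
Qed.

Let measurable_sqr_defect : measurable_fun setT (fun x : HB => (defect M x ^+
  2)%:E).
Proof. by apply/measurable_EFinP; apply: measurable_funX;
  exact: measurable_defect. Qed.

Definition sqr_dist_mean k := (\int[P]_w (`|X k w - p| ^+ 2)%:E)%E.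
Definition sqr_defect_mean k := (\int[P]_w (defect M (X k w) ^+ 2)%:E)%E.

Lemma defect_le_dist x : defect M x <= 2 * `|x - p|.
Proof.
have := defect_lip norm_dot S1 mS iS MS x p.
by rewrite {2}/defect Mp subrr normr0 add0r.
Qed.

(** Stated in the extended reals because the moments are not yet known to be finite; their
    finiteness follows from this inequality by induction on [k]. *)
Lemma sqr_dist_mean_rec k :
  (sqr_dist_mean k.+1 + (lambda k * (1 - lambda k))%:E * sqr_defect_mean k <=
   (1 + 8 * lambda k ^+ 2)%:E * sqr_dist_mean k +
   (2 * lambda k ^+ 2 * sigma ^+ 2)%:E)%E.
Proof.
set l := lambda k.
have mf : measurable_fun setT (fun z : HB * Xi => (`|km_step S l z.1 z.2 - p|
  ^+ 2)%:E).
  exact: (measurableT_comp (measurable_sqr_dist p) (km_step_borel (l0 k) (l1 k))).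
have f0 (z : HB * Xi) : (0 <= (`|km_step S l z.1 z.2 - p| ^+ 2)%:E)%E.
  by rewrite lee_fin sqr_ge0.
have -> : sqr_dist_mean k.+1 =
    (\int[P]_w \int[D]_s (`|km_step S l (X k w) s - p| ^+ 2)%:E)%E.
  exact: (fresh_law (fresh_iterate k) mf f0).
have c0 : 0 <= 2 * l ^+ 2 * sigma ^+ 2 by rewrite mulr_ge0 ?sqr_ge0 // mulr_ge0
  ?sqr_ge0.
have l2 : 0 <= l * (1 - l) by rewrite mulr_ge0 ?subr_ge0 // ?l0 ?l1.
have mX c : measurable_fun setT (fun w => (`|X k w - c| ^+ 2)%:E).
  exact: (measurableT_comp (measurable_sqr_dist c) (measurable_iterate k)).
have mdX : measurable_fun setT (fun w => (defect M (X k w) ^+ 2)%:E).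
  exact: (measurableT_comp measurable_sqr_defect (measurable_iterate k)).
have mI : measurable_fun setT
    (fun w => \int[D]_s (`|km_step S l (X k w) s - p| ^+ 2)%:E)%E.
  exact: (measurableT_comp (measurable_fun_fubini_tonelli_F (m2 := D) _ mf f0)
    (measurable_iterate k)).
rewrite /sqr_defect_mean -ge0_integralZl //; last by move=> w _;
  rewrite lee_fin sqr_ge0.
rewrite -ge0_integralD //; last 3 first.
- by move=> w _; apply: integral_ge0 => s _; rewrite lee_fin sqr_ge0.
- by move=> w _; rewrite mule_ge0 // lee_fin // sqr_ge0.
- by apply: emeasurable_funM.
have -> : ((1 + 8 * l ^+ 2)%:E * sqr_dist_mean k + (2 * l ^+ 2 * sigma ^+ 2)%:E =
    \int[P]_w ((1 + 8 * l ^+ 2)%:E * (`|X k w - p| ^+ 2)%:E +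
               (2 * l ^+ 2 * sigma ^+ 2)%:E))%E.
  rewrite ge0_integralD //.
  - rewrite ge0_integralZl // ?integral_cst //.
      by rewrite [X in _ = (_ + _ * X)%E](probability_setT P) mule1.
    by rewrite lee_fin addr_ge0 // mulr_ge0 // sqr_ge0.
  - by move=> w _; rewrite -EFinM lee_fin mulr_ge0 ?sqr_ge0 // addr_ge0 //
      mulr_ge0 ?sqr_ge0.
  - by apply: emeasurable_funM.
apply: ge0_le_integral => //.
- move=> w _; rewrite adde_ge0 // ?mule_ge0 ?lee_fin ?sqr_ge0 //.
  by apply: integral_ge0 => s _; rewrite lee_fin sqr_ge0.
- by apply: emeasurable_funD => //; apply: emeasurable_funM.
- by apply: emeasurable_funD => //; apply: emeasurable_funM.
- move=> w _; rewrite -!EFinM -EFinD.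
  by apply: (km_step_fixed_point norm_dot S1 mS iS MS Mp varp); rewrite ?l0 ?l1.
Qed.

Lemma sqr_dist_mean_fin k : sqr_dist_mean k \is a fin_num.
Proof.
elim: k => [|k IH].
  rewrite /sqr_dist_mean /X /= integral_cst //.
  by rewrite [X in (_ * X)%E](probability_setT P) mule1.
rewrite ge0_fin_numE; last by apply: integral_ge0 => w _; rewrite lee_fin sqr_ge0.
apply: (@le_lt_trans _ _ ((1 + 8 * lambda k ^+ 2)%:E * sqr_dist_mean k +
   (2 * lambda k ^+ 2 * sigma ^+ 2)%:E)%E).
  apply: le_trans (sqr_dist_mean_rec k); apply: leeDl.
  rewrite mule_ge0 ?lee_fin ?mulr_ge0 ?subr_ge0 ?l0 ?l1 //.
  by apply: integral_ge0 => w _; rewrite lee_fin sqr_ge0.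
by rewrite -(fineK IH) -EFinM -EFinD ltry.
Qed.

Let measurable_sqr_dist_iterate k c : measurable_fun setT (fun w => (`|X k w -
  c| ^+ 2)%:E).
Proof. exact: (measurableT_comp (measurable_sqr_dist c) (measurable_iterate
  k)). Qed.

Lemma measurable_defect_iterate k : measurable_fun setT (fun w => defect M (X k
  w)).
Proof. exact: (measurableT_comp measurable_defect (measurable_iterate k)). Qed.

Let measurable_sqr_defect_iterate k :
  measurable_fun setT (fun w => (defect M (X k w) ^+ 2)%:E).
Proof. exact: (measurableT_comp measurable_sqr_defect (measurable_iterate k)).
  Qed.

Lemma sqr_defect_mean_fin k : sqr_defect_mean k \is a fin_num.
Proof.
rewrite ge0_fin_numE; last by apply: integral_ge0 => w _; rewrite lee_fin sqr_ge0.
apply: (@le_lt_trans _ _ (\int[P]_w (4%:E * (`|X k w - p| ^+ 2)%:E))%E).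
  apply: ge0_le_integral => //.
  - by move=> w _; rewrite lee_fin sqr_ge0.
  - by apply: emeasurable_funM.
  - move=> w _; rewrite -EFinM lee_fin.
    have -> : 4 * `|X k w - p| ^+ 2 = (2 * `|X k w - p|) ^+ 2 by ring.
    by rewrite lerXn2r ?nnegrE ?defect_ge0 ?mulr_ge0 // defect_le_dist.
rewrite ge0_integralZl // -/(sqr_dist_mean k).
by rewrite -(fineK (sqr_dist_mean_fin k)) -EFinM ltry.
Qed.

Definition mdist k : R := fine (sqr_dist_mean k).
Definition mdefect k : R := fine (sqr_defect_mean k).

Lemma mdist_ge0 k : 0 <= mdist k.
Proof. by apply: fine_ge0; apply: integral_ge0 => w _;
  rewrite lee_fin sqr_ge0. Qed.

Lemma mdefect_ge0 k : 0 <= mdefect k.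
Proof. by apply: fine_ge0; apply: integral_ge0 => w _;
  rewrite lee_fin sqr_ge0. Qed.

Lemma mdist0 : mdist 0 = `|x0 - p| ^+ 2.
Proof.
rewrite /mdist /sqr_dist_mean /X /= integral_cst //.
by rewrite [X in (_ * X)%E](probability_setT P) mule1.
Qed.

Lemma mdist_rec k : mdist k.+1 + lambda k * (1 - lambda k) * mdefect k <=
  (1 + 8 * lambda k ^+ 2) * mdist k + 2 * lambda k ^+ 2 * sigma ^+ 2.
Proof.
have := sqr_dist_mean_rec k.
rewrite -(fineK (sqr_dist_mean_fin k)) -(fineK (sqr_dist_mean_fin k.+1)).
by rewrite -(fineK (sqr_defect_mean_fin k)) -!EFinM -!EFinD lee_fin.
Qed.

(* The iterates are compared with the noiseless iteration restarted at time i: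
   the defect does not increase along the latter, and, its steps being
   nonexpansive, the mean square gap is at most the noise variance since time
     i. *)
Fixpoint restart i n (w : Omega) : H :=
  if n is n'.+1 then relaxed M (lambda (i + n')) (restart i n' w) else X i w.

Lemma defect_restart i n w : defect M (restart i n w) <= defect M (X i w).
Proof.
elim: n => [//|n IH] /=; apply: le_trans IH.
exact: (defect_relaxed norm_dot S1 mS iS MS).
Qed.

(** Freshness is needed for the pair: the gap depends on both components, and its next value on both
    together with the new sample. Freshness of each component alone would not give their joint law
    with that sample. *)
Lemma fresh_restart i n :
  fresh D xi (i + n) (fun w => (X (i + n) w : HB, restart i n w : HB)).
Proof.
elim: n => [|n IH].
  rewrite addn0.
  have := @fresh_comp _ _ _ _ _ P D xi i _ HB _ (HB * HB)%type (X i)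
    (fun x => (x, x)) _ (fresh_iterate i).
  by apply; apply: measurable_fun_pair; exact: measurable_id.
rewrite addnS.
pose V (z : (HB * HB) * Xi) : HB * HB :=
  (km_step S (lambda (i + n)) z.1.1 z.2, relaxed M (lambda (i + n)) z.1.2).
apply: (fresh_step IH (U := V)); apply: measurable_fun_pair.
  apply: (measurableT_comp (km_step_borel (l0 (i + n)) (l1 (i + n)))
     (g := fun z : (HB * HB) * Xi => (z.1.1, z.2))).
  apply: measurable_fun_pair; last exact: measurable_snd.
  exact: (measurableT_comp measurable_fst measurable_fst).
apply: (measurableT_comp (relaxed_borel (l0 (i + n)) (l1 (i + n)))).
exact: (measurableT_comp measurable_snd measurable_fst).
Qed.

Let measurable_pair_dist : measurable_fun setT
  (fun z : HB * HB => (`|(z.1 : H) - z.2| ^+ 2)%:E).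
Proof.
apply/measurable_EFinP; apply: measurable_funX.
by apply: (@borel_measurable_dist _ _ sepH _ (HB * HB)%type fst snd);
  [exact: measurable_fst|exact: measurable_snd].
Qed.

Definition gap i n := (\int[P]_w (`|X (i + n) w - restart i n w| ^+ 2)%:E)%E.

Let noise k := lambda k ^+ 2 * (8 * mdist k + 2 * sigma ^+ 2).

Lemma gap_le i n : (gap i n <= (\sum_(i <= j < i + n) noise j)%:E)%E.
Proof.
elim: n => [|n IH].
  rewrite addn0 big_geq // /gap.
  under eq_integral do rewrite addn0 /= subrr normr0 expr0n /=.
  by rewrite integral0.
rewrite addnS big_nat_recr ?leq_addr //= EFinD.
apply: le_trans (leeD IH (lexx _)).
set k := (i + n)%N; set l := lambda k.
pose f (z : (HB * HB) * Xi) := (`|km_step S l z.1.1 z.2 - relaxed M l z.1.2| ^+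
  2)%:E.
have mf : measurable_fun setT f.
  apply: (measurableT_comp measurable_pair_dist (g := fun z : (HB * HB) * Xi =>
    (km_step S l z.1.1 z.2 : HB, relaxed M l z.1.2 : HB))).
  apply: measurable_fun_pair.
    apply: (measurableT_comp (km_step_borel (l0 k) (l1 k))
       (g := fun z : (HB * HB) * Xi => (z.1.1, z.2))).
    apply: measurable_fun_pair; last exact: measurable_snd.
    exact: (measurableT_comp measurable_fst measurable_fst).
  apply: (measurableT_comp (relaxed_borel (l0 k) (l1 k))).
  exact: (measurableT_comp measurable_snd measurable_fst).
have f0 z : (0 <= f z)%E by rewrite lee_fin sqr_ge0.
have -> : gap i n.+1 =
    (\int[P]_w \int[D]_s (`|km_step S l (X k w) s - relaxed M l (restart i n
      w)| ^+ 2)%:E)%E.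
  rewrite /gap addnS.
  exact: (fresh_law (fresh_restart i n) mf f0).
have mgap : measurable_fun setT (fun w => (`|X k w - restart i n w| ^+ 2)%:E).
  by case: (fresh_restart i n) => m _;
    exact: (measurableT_comp measurable_pair_dist m).
have c0 : 0 <= l ^+ 2 * (2 * sigma ^+ 2).
  by rewrite mulr_ge0 ?sqr_ge0 // mulr_ge0 ?sqr_ge0.
have d0 : 0 <= l ^+ 2 * 8 by rewrite mulr_ge0 ?sqr_ge0.
apply: (@le_trans _ _ (\int[P]_w ((`|X k w - restart i n w| ^+ 2)%:E +
    ((l ^+ 2 * 8)%:E * (`|X k w - p| ^+ 2)%:E + (l ^+ 2 * (2 * sigma ^+
      2))%:E)))%E).
  apply: ge0_le_integral => //.
  - by move=> w _; apply: integral_ge0 => s _; rewrite lee_fin sqr_ge0.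
  - case: (fresh_restart i n) => m _.
    exact: (measurableT_comp (measurable_fun_fubini_tonelli_F (m2 := D) _ mf
      f0) m).
  - by apply: emeasurable_funD => //; apply: emeasurable_funD => //;
      apply: emeasurable_funM.
  - move=> w _; rewrite -EFinM -!EFinD.
    have := km_step_relaxed norm_dot S1 mS iS MS varp (X k w) (restart i n w)
      (l0 k) (l1 k).
    by rewrite /noise_bound mulrDr (mulrA _ 8).
rewrite ge0_integralD //; last 2 first.
- by move=> w _; rewrite -EFinM -EFinD lee_fin addr_ge0 // mulr_ge0 ?sqr_ge0.
- by apply: emeasurable_funD => //; apply: emeasurable_funM.
apply: leeD => //.
rewrite ge0_integralD //; last 2 first.
- by move=> w _; rewrite -EFinM lee_fin mulr_ge0 ?sqr_ge0.
- by apply: emeasurable_funM.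
rewrite ge0_integralZl // integral_cst //.
rewrite -/(sqr_dist_mean k) -(fineK (sqr_dist_mean_fin k)) -/(mdist k).
rewrite [X in (_ + _ * X)%E](probability_setT P) mule1 -EFinM -EFinD lee_fin.
by rewrite le_eqVlt /noise /l; apply/orP; left; apply/eqP; ring.
Qed.

Lemma mdefect_le i n :
  mdefect (i + n) <= 2 * mdefect i + 8 * \sum_(i <= j < i + n) noise j.
Proof.
rewrite -lee_fin fineK ?sqr_defect_mean_fin // EFinD !EFinM fineK
  ?sqr_defect_mean_fin //.
apply: le_trans (leeD (lexx _) (lee_wpmul2l _ (gap_le i n)));
  last by rewrite lee_fin.
have mgap : measurable_fun setT (fun w => (`|X (i + n) w - restart i n w| ^+
  2)%:E).
  by case: (fresh_restart i n) => m _;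
    exact: (measurableT_comp measurable_pair_dist m).
rewrite -ge0_integralZl //; last by move=> w _; rewrite lee_fin sqr_ge0.
rewrite -[X in (_ <= _ + X)%E]ge0_integralZl //.
rewrite -ge0_integralD //; last 3 first.
- by move=> w _; rewrite -EFinM lee_fin mulr_ge0 ?sqr_ge0.
- by apply: emeasurable_funM.
- by apply: emeasurable_funM.
apply: ge0_le_integral => //.
- by move=> w _; rewrite lee_fin sqr_ge0.
- by apply: emeasurable_funD; apply: emeasurable_funM.
- move=> w _; rewrite -!EFinM -EFinD lee_fin.
  set g := `|_ - _|; have g0 : 0 <= g by exact: normr_ge0.
  have d0 x : 0 <= defect M x by exact: defect_ge0.
  have h : defect M (X (i + n) w) <= defect M (X i w) + 2 * g.
    apply: le_trans (defect_lip norm_dot S1 mS iS MS _ (restart i n w)) _.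
    by rewrite lerD2r defect_restart.
  have h2 : defect M (X (i + n) w) ^+ 2 <= (defect M (X i w) + 2 * g) ^+ 2.
    by rewrite lerXn2r ?nnegrE ?d0 // addr_ge0 ?d0 // mulr_ge0.
  have -> : 2 * defect M (X i w) ^+ 2 + 8 * g ^+ 2 =
      (defect M (X i w) + 2 * g) ^+ 2 + (defect M (X i w) - 2 * g) ^+ 2 by ring.
  by rewrite (le_trans h2) // lerDl sqr_ge0.
Qed.

End Process.

(** * Deterministic consequences of the moment inequalities *)

Section Recursion.
Context (R : realType) (m rho lam : nat -> R) (sigma delta : R).
Context (m_ge0 : forall k, 0 <= m k) (rho_ge0 : forall k, 0 <= rho k)
        (lam_ge0 : forall k, 0 <= lam k)
        (delta_gt0 : 0 < delta) (lam_le : forall k, delta <= 1 - lam k).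
Context (m_rec : forall k, m k.+1 + lam k * (1 - lam k) * rho k <=
          (1 + 8 * lam k ^+ 2) * m k + 2 * lam k ^+ 2 * sigma ^+ 2).
Context (rho_le : forall i n, rho (i + n) <=
          2 * rho i + 8 * \sum_(i <= j < i + n) (lam j ^+ 2 * (8 * m j + 2 *
            sigma ^+ 2))).

(** Discrete Gronwall bound: the growth factors [1 + 8 lam k ^+ 2] multiply to at most
    [expR (8 * Q)]. The schedule enters only through [Q]. *)
Definition dist_bound (m0 Q : R) := (m0 + 2 * sigma ^+ 2 * Q) * expR (8 * Q).
Definition noise_sup (m0 Q : R) := 8 * dist_bound m0 Q + 2 * sigma ^+ 2.
Definition energy_bound (m0 Q : R) := (m0 + Q * noise_sup m0 Q) / delta.

Let q K := \sum_(k < K) lam k ^+ 2.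

Let q_ge0 K : 0 <= q K.
Proof. by apply: sumr_ge0 => k _; exact: sqr_ge0. Qed.

Let q_le k K : (k <= K)%N -> q k <= q K.
Proof.
move=> kK; rewrite /q -!(big_mkord xpredT (fun k => lam k ^+ 2)).
rewrite (@big_cat_nat _ _ _ k 0 K) //= lerDl.
by apply: sumr_ge0 => j _; exact: sqr_ge0.
Qed.

Let s2 : 0 <= 2 * sigma ^+ 2.
Proof. by rewrite mulr_ge0 ?sqr_ge0. Qed.

(** The induction uses the current partial sum [q k] and not its final bound: each new factor is
    absorbed by [1 + y <= expR y], and the additive noise may be multiplied by an exponential, which
    is at least 1. *)
Let m_le_q k : m k <= dist_bound (m 0) (q k).
Proof.
elim: k => [|k IH].
  by rewrite /dist_bound /q big_ord0 !mulr0 addr0 expR0 mulr1.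
have l2 : 0 <= lam k ^+ 2 by exact: sqr_ge0.
have step : m k.+1 <= (1 + 8 * lam k ^+ 2) * m k + 2 * sigma ^+ 2 * lam k ^+ 2.
  have := m_rec k.
  have : 0 <= lam k * (1 - lam k) * rho k.
    by rewrite !mulr_ge0 // (le_trans (ltW delta_gt0)).
  lra.
apply: (le_trans step).
have -> : q k.+1 = q k + lam k ^+ 2 by rewrite /q big_ord_recr.
have h1 : (1 + 8 * lam k ^+ 2) * m k <= expR (8 * lam k ^+ 2) * dist_bound (m
  0) (q k).
  by apply: ler_pM => //; [rewrite addr_ge0 ?mulr_ge0|exact: expR_ge1Dx].
have h2 : 2 * sigma ^+ 2 * lam k ^+ 2 <=
    2 * sigma ^+ 2 * lam k ^+ 2 * expR (8 * q k + 8 * lam k ^+ 2).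
  have e1 : 1 <= expR (8 * q k + 8 * lam k ^+ 2).
    by rewrite -[leLHS]expR0 ler_expR addr_ge0 // mulr_ge0.
  by rewrite ler_peMr // mulr_ge0.
apply: (le_trans (lerD h1 h2)); rewrite le_eqVlt; apply/orP; left; apply/eqP.
by rewrite /dist_bound (mulrDr 8) !expRD; ring.
Qed.

Lemma dist_bound_mono m0 Q Q' : 0 <= m0 -> 0 <= Q -> Q <= Q' ->
  dist_bound m0 Q <= dist_bound m0 Q'.
Proof.
move=> h0 hQ QQ'; apply: ler_pM.
- by rewrite addr_ge0 // mulr_ge0.
- exact: expR_ge0.
- by rewrite lerD2l ler_wpM2l.
- by rewrite ler_expR ler_wpM2l.
Qed.

Section Horizon.
Context (K : nat) (Q : R) (qQ : \sum_(k < K) lam k ^+ 2 <= Q).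

Let Q_ge0 : 0 <= Q.
Proof. exact: le_trans (q_ge0 K) qQ. Qed.

(** The sum of squares is controlled up to the horizon [K] only, and so is the conclusion. A
    constant parameter tuned to [K] has a divergent sum over all times. *)
Lemma m_le k : (k <= K)%N -> m k <= dist_bound (m 0) Q.
Proof.
move=> kK; apply: le_trans (m_le_q k) _; apply: dist_bound_mono => //.
exact: le_trans (q_le kK) qQ.
Qed.

Let noise_le k : (k <= K)%N -> 8 * m k + 2 * sigma ^+ 2 <= noise_sup (m 0) Q.
Proof. by move=> kK; rewrite lerD2r ler_wpM2l // m_le. Qed.

Lemma noise_sup_ge0 : 0 <= noise_sup (m 0) Q.
Proof. by apply: le_trans (noise_le (leq0n K)); rewrite addr_ge0 // mulr_ge0. Qed.

Lemma energy_le : \sum_(k < K) lam k * rho k <= energy_bound (m 0) Q.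
Proof.
rewrite /energy_bound ler_pdivlMr // mulrC.
(* Telescoped recursion: the growth term and the variance together are
   [lam n ^+ 2 * (8 * m n + 2 * sigma ^+ 2)], which [noise_sup] bounds, while [1 - lam n >= delta]
   keeps the energy term. *)
have tele n : (n <= K)%N -> m n + delta * (\sum_(k < n) lam k * rho k) <=
    m 0 + q n * noise_sup (m 0) Q.
  elim: n => [|n IH] nK; first by rewrite /q !big_ord0 mulr0 mul0r.
  rewrite /q !big_ord_recr /= -/(q n).
  have := IH (ltnW nK); have := m_rec n.
  have : lam n ^+ 2 * (8 * m n + 2 * sigma ^+ 2) <= lam n ^+ 2 * noise_sup (m
    0) Q.
    by rewrite ler_wpM2l ?sqr_ge0 // noise_le // ltnW.
  have : delta * (lam n * rho n) <= (1 - lam n) * (lam n * rho n).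
    by rewrite ler_wpM2r // mulr_ge0.
  lra.
have := tele K (leqnn K); have := m_ge0 K.
have : q K * noise_sup (m 0) Q <= Q * noise_sup (m 0) Q.
  by rewrite ler_wpM2r // noise_sup_ge0.
lra.
Qed.

(* Averages the restart estimate over the restarting times in [m', K). *)
Lemma last_le m' : (m' <= K)%N ->
  (\sum_(m' <= k < K) lam k) * rho K <=
  2 * energy_bound (m 0) Q +
  8 * noise_sup (m 0) Q * (\sum_(m' <= k < K) lam k ^+ 2) * \sum_(m' <= k < K)
    lam k.
Proof.
move=> mK.
have one k : (m' <= k < K)%N -> lam k * rho K <= 2 * (lam k * rho k) +
    8 * noise_sup (m 0) Q * (\sum_(m' <= k < K) lam k ^+ 2) * lam k.
  move=> /andP[mk kK].
  have := rho_le k (K - k); rewrite subnKC ?(ltnW kK) // => h.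
  have h2 : \sum_(k <= j < K) lam j ^+ 2 * (8 * m j + 2 * sigma ^+ 2) <=
      noise_sup (m 0) Q * \sum_(m' <= k < K) lam k ^+ 2.
    rewrite (@big_cat_nat _ _ _ k m' K) ?(ltnW kK) //= mulrDr.
    apply: ler_wpDl.
      by rewrite mulr_ge0 ?noise_sup_ge0 // sumr_ge0 // => j _; exact: sqr_ge0.
    rewrite mulr_sumr ler_sum_nat // => j /andP[_ jK].
    by rewrite mulrC ler_wpM2r ?sqr_ge0 // noise_le // ltnW.
  have := ler_wpM2l (lam_ge0 k) (le_trans h (lerD (lexx _) (ler_wpM2l _ h2))).
  by move=> /(_ (ler0n _ _)); lra.
rewrite mulr_suml (le_trans (ler_sum_nat one)) // big_split /= -!mulr_sumr lerD2r.
rewrite ler_wpM2l //; apply: le_trans energy_le.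
rewrite -(big_mkord xpredT (fun k => lam k * rho k)).
rewrite (@big_cat_nat _ _ _ m' 0 K) //= lerDr.
by apply: sumr_ge0 => j _; rewrite mulr_ge0.
Qed.

(** Each factor satisfies [(1 + y)^-1 >= expR (- y)]. With the upper bound 1, this makes the index
    weights comparable to [lam k] up to constants. *)
Lemma Lambda_ge k : (k <= K)%N -> expR (- (2 * Q)) <= Lambda lam k.
Proof.
move=> kK; apply: (@le_trans _ _ (expR (- (2 * q k)))).
  by rewrite ler_expR lerN2 ler_wpM2l // (le_trans (q_le kK)).
rewrite /Lambda /q mulr_sumr -sumrN expR_sum; apply: ler_prod => i _.
rewrite expR_ge0 /= expRN lef_pV2 ?posrE ?expR_gt0 ?expR_ge1Dx //.
by rewrite ltr_wpDr // mulr_ge0 ?sqr_ge0.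
Qed.

Lemma Lambda_le1 k : Lambda lam k <= 1.
Proof.
apply: prodr_ile1 => i _; have h : 0 <= 2 * lam i ^+ 2 by rewrite mulr_ge0
  ?sqr_ge0.
by rewrite invr_ge0 addr_ge0 //= invf_le1 ?lerDl // ltr_wpDr.
Qed.

Lemma Lambda_ge0 k : 0 <= Lambda lam k.
Proof.
apply: prodr_ge0 => i _; by rewrite invr_ge0 addr_ge0 // mulr_ge0 ?sqr_ge0.
Qed.

Lemma index_weight_ge0 k : 0 <= index_weight lam k.
Proof.
by rewrite /index_weight !mulr_ge0 ?Lambda_ge0 // (le_trans (ltW delta_gt0)).
Qed.

(** In the numerator the weights are at most [lam k], which leaves the energy; in the denominator
    they are at least [delta * expR (- (2 * Q)) * lam k]. *)
Lemma index_weight_mean_le : 0 < \sum_(k < K) lam k ->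
  \sum_(k < K) (index_weight lam k / \sum_(k' < K) index_weight lam k') * rho k <=
  energy_bound (m 0) Q / (delta * expR (- (2 * Q))) / \sum_(k < K) lam k.
Proof.
move=> SK.
have W : delta * expR (- (2 * Q)) * \sum_(k < K) lam k <= \sum_(k < K)
  index_weight lam k.
  rewrite mulr_sumr; apply: ler_sum => k _.
  rewrite -mulrA mulrC; apply: ler_pM => //.
  - by rewrite mulr_ge0 ?expR_ge0.
  - exact: ltW.
  - by rewrite ler_wpM2r // Lambda_ge.
have W0 : 0 < delta * expR (- (2 * Q)) * \sum_(k < K) lam k.
  by rewrite !mulr_gt0 // expR_gt0.
under eq_bigr do rewrite mulrAC.
rewrite -mulr_suml -[leRHS]mulrA -invfM.
apply: ler_pM.
- by apply: sumr_ge0 => k _; rewrite mulr_ge0 ?index_weight_ge0.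
- by rewrite invr_ge0 (le_trans (ltW W0)).
- apply: le_trans energy_le; apply: ler_sum => k _.
  rewrite ler_wpM2r // /index_weight -mulrA mulrCA ler_piMr //.
  rewrite mulr_ile1 ?Lambda_ge0 ?Lambda_le1 //.
    by rewrite (le_trans (ltW delta_gt0)).
  by rewrite gerBl.
- by rewrite lef_pV2 ?posrE // (lt_le_trans W0).
Qed.
End Horizon.
End Recursion.

(** * Expectations of residuals *)

Section Expectation.
Context d (T : measurableType d) (R : realType).
Import HBNNSimple.

(** No measurability of [f] is assumed. Raising [g] to [+oo] on the exceptional null set keeps its
    integral, and every simple function below [f] then lies below the modified [g] everywhere. *)
Lemma ge0_le_integral_ae (mu : {measure set T -> \bar R}) (f g : T -> \bar R) :
  (forall x, 0 <= f x)%E -> (forall x, 0 <= g x)%E -> measurable_fun setT g ->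
  {ae mu, forall x, (f x <= g x)%E} -> (\int[mu]_x f x <= \int[mu]_x g x)%E.
Proof.
move=> f0 g0 mg [N [mN N0 fg]].
pose h x := if x \in N then +oo%E else g x.
have mh : measurable_fun setT h.
  apply: measurable_fun_ifT => //.
  by apply: (measurable_fun_bool true); rewrite setTI preimage_mem_true.
have h0 x : (0 <= h x)%E by rewrite /h; case: ifP.
have -> : (\int[mu]_x g x = \int[mu]_x h x)%E.
  apply: ae_eq_integral => //; exists N; split=> // x /= /not_implyP[_ gh].
  apply: contrapT => nN; apply: gh; rewrite /h.
  by case: ifPn => // /set_mem.
rewrite !ge0_integralTE //; apply: le_ereal_sup => _ [s sf <-].
exists s => // x; rewrite /h; case: ifPn => [|/negP xN]; first by rewrite leey.
apply: le_trans (sf x) _; apply: contrapT => /negP fgx; apply: xN.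
by apply/mem_set/fg => /=; exact/negP.
Qed.

(* Young's inequality [r <= (c + r ^ 2 / c) / 2] bounds a mean by a second
   moment at the scale [c]. *)
Lemma expectation_le_sqr (P : probability T R) (r g : T -> R) (c rho : R) :
  0 < c -> (forall w, 0 <= r w) -> (forall w, 0 <= g w) ->
  measurable_fun setT g -> {ae P, forall w, r w ^+ 2 <= g w} ->
  (\int[P]_w (g w)%:E <= rho%:E)%E ->
  ('E_P[r] <= ((c + rho / c) / 2)%:E)%E.
Proof.
move=> c0 r0 g0 mg rg Eg; rewrite unlock.
apply: (@le_trans _ _ (\int[P]_w ((c / 2)%:E + ((2 * c)^-1)%:E * (g w)%:E))%E).
  apply: ge0_le_integral_ae.
  - by move=> w; rewrite lee_fin.
  - move=> w; rewrite -EFinM lee_fin addr_ge0 //.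
      by rewrite divr_ge0 // ltW.
    by rewrite mulr_ge0 // invr_ge0 mulr_ge0 // ltW.
  - by apply: emeasurable_funD => //; apply: emeasurable_funM => //;
      exact/measurable_EFinP.
  - apply: filterS rg => w rgw.
    rewrite -EFinM lee_fin.
    have -> : c / 2 + (2 * c)^-1 * g w = (c ^+ 2 + g w) / (2 * c).
      by field; rewrite gt_eqF.
    rewrite ler_pdivlMr ?mulr_gt0 //.
    have := sqr_ge0 (c - r w); rewrite sqrrB; move: rgw; lra.
have mg' : measurable_fun setT (fun w => (g w)%:E) by exact/measurable_EFinP.
have c2 : 0 <= (2 * c)^-1 by rewrite invr_ge0 mulr_ge0 // ltW.
rewrite ge0_integralD //; last 3 first.
- by move=> w _; rewrite lee_fin divr_ge0 // ltW.
- by move=> w _; rewrite -EFinM lee_fin mulr_ge0.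
- by apply: emeasurable_funM.
rewrite ge0_integralZl // ?integral_cst //; last by move=> w _; rewrite lee_fin.
rewrite [X in (_ * X + _)%E](probability_setT P) mule1.
apply: (@le_trans _ _ ((c / 2)%:E + ((2 * c)^-1)%:E * rho%:E)%E).
  by apply: leeD => //; apply: lee_wpmul2l.
rewrite -EFinM -EFinD lee_fin le_eqVlt; apply/orP; left; apply/eqP.
by field; rewrite gt_eqF.
Qed.

Lemma independent_integral (P : probability T R) (N : {RV P >-> nat}) dS
    (S : measurableType dS) (Y : T -> S) (mY : measurable_fun setT Y)
    (phi : S -> \bar R) (k : nat) :
  (forall A B, measurable B ->
    P (N @^-1` A `&` Y @^-1` B) = (P (N @^-1` A) * P (Y @^-1` B))%E) ->
  measurable_fun setT phi -> (forall y, 0 <= phi y)%E ->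
  (\int[P]_w ((\1_[set k] (N w))%:E * phi (Y w)) =
   P (N @^-1` [set k]) * \int[P]_w phi (Y w))%E.
Proof.
move=> ind mphi phi0.
pose Ym : {mfun T >-> S} := HB.pack Y (isMeasurableFun.Build _ _ _ _ Y mY).
pose Z w := (N w, Y w).
have mZ : measurable_fun setT Z.
  by apply: measurable_fun_pair => //; exact: measurable_funPT.
pose Zm : {mfun T >-> (nat * S)%type} := HB.pack Z (isMeasurableFun.Build _ _ _
  _ Z mZ).
pose f (z : nat * S) : \bar R := ((\1_[set k] z.1)%:E * phi z.2)%E.
have mf : measurable_fun setT f.
  apply: emeasurable_funM; last exact: (measurableT_comp mphi measurable_snd).
  apply/measurable_EFinP.
  have m1 : measurable_fun setT (\1_[set k] : nat -> R) by exact: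
    measurable_indic.
  exact: (measurableT_comp m1 measurable_fst).
have f0 z : (0 <= f z)%E by rewrite mule_ge0 // lee_fin.
transitivity (\int[distribution P Zm]_z f z)%E.
  by rewrite ge0_integral_distribution.
transitivity (\int[(distribution P N \x distribution P Ym)%E]_z f z)%E.
  apply: eq_measure_integral => E mE _.
  apply: esym; apply: product_measure_unique => // A B mA mB; exact: ind.
rewrite fubini_tonelli1 // /fubini_F /f /=.
under eq_integral => n _.
  rewrite ge0_integralZl //.
  rewrite ge0_integral_distribution //.
  over.
rewrite ge0_integralZr //.
- by rewrite integral_indic // setIT.
- by apply: integral_ge0 => w _; exact: phi0.
Qed.
End Expectation.

Section ProcessMeasurability.
Context (R : realType) (H : completeNormedModType R) (sepH : separable H).
Context (dX : measure_display) (Xi : measurableType dX).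
Context (S : Xi -> H -> H) (S1 : forall s, nonexpansive (S s))
        (mS : forall x, borel_measurable (fun s => S s x)).
Context (dO : measure_display) (Omega : measurableType dO)
        (P : probability Omega R) (xi : nat -> {RV P >-> Xi}) (x0 : H)
        (lambda : nat -> R)
        (l0 : forall k, 0 <= lambda k) (l1 : forall k, lambda k <= 1).
Notation HB := (g_sigma_algebraType (@open H)).

Lemma iterate_process_measurable k (B : set HB) : measurable B ->
  process_sigma_algebra xi ((skm S lambda x0 xi k : Omega -> HB) @^-1` B).
Proof.
(* Omega carries here the sigma-algebra generated by the samples. *)
pose G := \bigcup_j preimage_set_system setT (xi j) (@measurable _ Xi).
have mxi j : measurable_fun setT (xi j : g_sigma_algebraType G -> Xi).
  move=> _ C mC; apply: sub_sigma_algebra.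
  by exists j => //; exists C.
have mX : measurable_fun setT (skm S lambda x0 xi k : g_sigma_algebraType G ->
  HB).
  elim: k => [|k IH]; first exact: measurable_cst.
  apply: (measurableT_comp (km_step_borel sepH S1 mS (l0 k) (l1 k))
    (g := fun w : g_sigma_algebraType G =>
       (skm S lambda x0 xi k w : HB, xi k w : Xi))).
  exact: measurable_fun_pair.
move=> mB; have := mX measurableT B mB.
by rewrite setTI.
Qed.
End ProcessMeasurability.

(** * Passage to an everywhere nonexpansive version, and moment estimates *)

Section Bounds.
Context (R : realType) (H : completeNormedModType R) (dot : {dot H for idfun})
        (norm_dot : forall x : H, dot x x = `|x| ^+ 2) (sepH : separable H).
Context (dX : measure_display) (Xi : measurableType dX) (D : probability Xi R)
        (T : Xi -> H -> H)
        (T1 : {ae D, forall s, nonexpansive (T s)})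
        (mT : forall x, borel_measurable (fun s => T s x))
        (iT : forall x, bochner_integrable D (fun s => T s x)).
Let M := mean_operator D T.
Context (sigma : R) (p : H) (Mp : M p = p)
        (varp : (\int[D]_s (`|T s p - M p| ^+ 2)%:E <= (sigma ^+ 2)%:E)%E).

Lemma nonexpansive_version : exists S : Xi -> H -> H,
  [/\ {ae D, forall s, S s = T s}, forall s, nonexpansive (S s),
      forall x, borel_measurable (fun s => S s x),
      forall x, D.-integrable setT (fun s => (`|S s x|)%:E)
    & (forall x h, dot (M x) h = \int[D]_s dot (S s x) h) /\
      (\int[D]_s (`|S s p - M p| ^+ 2)%:E <= (sigma ^+ 2)%:E)%E].
Proof.
have [N [mN N0 NT]] := T1.
(* On the null set the identity is used: it is nonexpansive, and its norm [|x|] is a constant in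
   [s], hence integrable. *)
pose S s x := if s \in N then x else T s x.
have ST s : ~ N s -> S s = T s.
  by move=> Ns; apply/funext => x; rewrite /S memNset.
have aeS : {ae D, forall s, S s = T s}.
  exists N; split=> // s /=; apply: contra_notP; exact: ST.
have S1 s : nonexpansive (S s).
  have [Ns|Ns] := pselect (N s); first by move=> x y; rewrite /S mem_set.
  rewrite ST //; apply: contrapT => nT; apply: Ns; exact: NT.
have mS x : borel_measurable (fun s => S s x).
  apply: measurable_fun_ifT => //.
    by apply: (measurable_fun_bool true); rewrite setTI preimage_mem_true.
  exact: mT.
have mnorm x : measurable_fun setT (fun s => (`|S s x|)%:E).
  apply/measurable_EFinP.
  by have := borel_measurable_norm 0 (mS x); under eq_fun do rewrite subr0.
have iTn x : D.-integrable setT (fun s => (`|T s x|)%:E).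
  by have [s as_] := iT x; exact: bochner_approx_integrable as_.
exists S; split=> //.
- move=> x; have icst : D.-integrable setT (EFin \o cst `|x|).
    exact: finite_measure_integrable_cst.
  apply: (le_integrable measurableT _ _ (integrableD measurableT (iTn x) icst))
    => //.
  move=> s _ /=; rewrite lee_fin normr_id [leRHS]ger0_norm ?addr_ge0 // /S.
  by case: ifP => _; rewrite ?lerDr ?lerDl.
- split.
    move=> x h; rewrite (bochner_integral_dot norm_dot sepH h (mT x) (iT x)).
    rewrite /Rintegral; congr fine; apply: ae_eq_integral => //.
    + apply/measurable_EFinP; exact: (measurable_dot norm_dot).
    + apply/measurable_EFinP; exact: (measurable_dot norm_dot).
    + by apply: filterS aeS => s -> _.
  apply: le_trans varp; apply: ge0_le_integral_ae.
  + by move=> s; rewrite lee_fin sqr_ge0.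
  + by move=> s; rewrite lee_fin sqr_ge0.
  + by apply/measurable_EFinP; apply: measurable_funX;
      exact: borel_measurable_norm.
  + by apply: filterS aeS => s ->.
Qed.

Context (dO : measure_display) (Omega : measurableType dO)
        (P : probability Omega R) (xi : nat -> {RV P >-> Xi})
        (iid : iid_from D xi) (x0 : H) (lambda : nat -> R)
        (delta : R) (delta_gt0 : 0 < delta) (l0 : forall k, 0 <= lambda k)
        (ld : forall k, delta <= 1 - lambda k).
Let r := residual D T lambda x0 xi.

Let l1 k : lambda k <= 1.
Proof. by rewrite -subr_ge0 (le_trans (ltW delta_gt0)). Qed.

(** Since [xi k] has law [D], the preimage of the null set is null for each [k]; countably many
    times cost nothing, and off their union both recursions take identical steps. *)
Lemma residual_version (S : Xi -> H -> H) : {ae D, forall s, S s = T s} ->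
  {ae P, forall w, forall k, r k w = defect M (skm S lambda x0 xi k w)}.
Proof.
move=> [N [mN N0 NS]].
have : {ae P, forall w, forall k, S (xi k w) = T (xi k w)}.
  apply: ae_foralln => k; exists (xi k @^-1` N); split.
  - exact: measurable_sample.
  - by have [law _] := iid; rewrite -(law k) in N0.
  - by move=> w /= h; apply: NS.
apply: filterS => w ST k; rewrite /r /residual /defect.
suff -> : skm T lambda x0 xi k w = skm S lambda x0 xi k w by [].
by elim: k => //= k ->; rewrite ST.
Qed.

(** Interface between probability and analysis: the version [S] is hidden and two real sequences
    remain. The scale [c] is left free and will be set to the target rate. *)
Lemma moment_sequences : exists m rho : nat -> R,
  [/\ m 0 = `|x0 - p| ^+ 2, forall k, 0 <= m k, forall k, 0 <= rho k,
      forall k, m k.+1 + lambda k * (1 - lambda k) * rho k <=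
          (1 + 8 * lambda k ^+ 2) * m k + 2 * lambda k ^+ 2 * sigma ^+ 2
    & forall i n, rho (i + n) <= 2 * rho i + 8 *
        \sum_(i <= j < i + n) (lambda j ^+ 2 * (8 * m j + 2 * sigma ^+ 2))] /\
  [/\ forall K c, 0 < c -> ('E_P[r K] <= ((c + rho K / c) / 2)%:E)%E,
      forall K (N : {RV P >-> nat}) c, random_index P lambda xi K N -> 0 < c ->
        ('E_P[fun w => r (N w) w] <= ((c + (\sum_(k < K)
          (index_weight lambda k / \sum_(k' < K) index_weight lambda k') * rho
            k) / c)
             / 2)%:E)%E
    & forall C, (forall K, \sum_(k < K) lambda k * rho k <= C) ->
        {ae P, forall w, exists B, forall K,
          \sum_(k < K) lambda k * r k w ^+ 2 <= B}].
Proof.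
have [S [aeS S1 mS iS [MS varS]]] := nonexpansive_version.
have fin k := sqr_defect_mean_fin norm_dot sepH S1 mS iS MS Mp varS iid x0 l0
  l1 k.
have md k := measurable_defect_iterate norm_dot sepH S1 mS iS MS iid x0 l0 l1 k.
have rS := residual_version aeS.
pose X := skm S lambda x0 xi.
have mX k : measurable_fun setT (X k : Omega -> g_sigma_algebraType (@open H)).
  by case: (fresh_iterate sepH S1 mS iid x0 l0 l1 k).
have mdM : measurable_fun setT (fun x : g_sigma_algebraType (@open H) =>
  (defect M x ^+ 2)%:E).
  apply/measurable_EFinP; apply: measurable_funX.
  exact: (measurable_defect norm_dot sepH S1 mS iS MS).
have E2 k : (\int[P]_w (defect M (X k w) ^+ 2)%:E =
    (mdefect S M xi x0 lambda k)%:E)%E by rewrite fineK.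
have r0 k w : 0 <= r k w by exact: normr_ge0.
exists (mdist S p xi x0 lambda), (mdefect S M xi x0 lambda); split; split.
- exact: mdist0.
- exact: mdist_ge0.
- exact: mdefect_ge0.
- exact: (mdist_rec norm_dot sepH S1 mS iS MS Mp varS iid x0 l0 l1).
- exact: (mdefect_le norm_dot sepH S1 mS iS MS Mp varS iid x0 l0 l1).
- move=> K c c0; apply: (expectation_le_sqr (g := fun w => defect M (X K w) ^+
    2)) => //.
  + by move=> w; exact: sqr_ge0.
  + exact: measurable_funX.
  + by apply: filterS rS => w ->.
  + by rewrite E2.
- move=> K N c [NK PN ind] c0.
  (* Splitting over the values of [N] makes each summand a product of independent factors; as
     [N w < K], exactly one summand survives at each [w]. *)
  pose g w := \sum_(k < K) \1_[set (k : nat)] (N w) * defect M (X k w) ^+ 2.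
  have m1 k : measurable_fun setT (fun w => \1_[set k] (N w) : R).
    have m1 : measurable_fun setT (\1_[set k] : nat -> R) by exact:
      measurable_indic.
    exact: (measurableT_comp m1 (measurable_funPT N)).
  apply: (expectation_le_sqr (g := g)) => //.
  + by move=> w; apply: sumr_ge0 => k _; rewrite mulr_ge0 ?sqr_ge0.
  + apply: measurable_sum => k; apply: measurable_funM => //.
    exact: measurable_funX.
  + apply: filterS rS => w ->; rewrite /g (bigD1 (Ordinal (NK w))) //=.
    rewrite indicE mem_set // mul1r lerDl sumr_ge0 // => k _.
    by rewrite mulr_ge0 ?sqr_ge0.
  + under eq_integral do rewrite -sumEFin.
    rewrite ge0_integral_sum //; last 2 first.
    * move=> k; apply/measurable_EFinP; apply: measurable_funM => //.
      exact: measurable_funX.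
    * by move=> k w _; rewrite lee_fin mulr_ge0 ?sqr_ge0.
    rewrite -sumEFin; apply: lee_sum => k _.
    under eq_integral do rewrite EFinM.
    rewrite (independent_integral (mX k) (phi := fun x => (defect M x ^+
      2)%:E)) //.
    * by rewrite E2 PN ?ltn_ord // -EFinM.
    (* [N] is independent of the sigma-algebra generated by the samples, so the iterate must be
       measurable for that smaller sigma-algebra. *)
    * move=> A B mB; apply: ind.
      exact: iterate_process_measurable.
    * by move=> y; rewrite lee_fin sqr_ge0.
- move=> C HC.
  have mt k : measurable_fun setT (fun w => (lambda k)%:E * (defect M (X k w)
    ^+ 2)%:E)%E.
    by apply: emeasurable_funM => //; apply/measurable_EFinP;
      exact: measurable_funX.
  have t0 k w : (0 <= (lambda k)%:E * (defect M (X k w) ^+ 2)%:E)%E.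
    by rewrite -EFinM lee_fin mulr_ge0 ?sqr_ge0.
  (* Monotone convergence bounds the mean of the whole series by [C], so the series is finite almost
     surely and its value is the required [B]. *)
  pose F w := (\sum_(0 <= k <oo) ((lambda k)%:E * (defect M (X k w) ^+ 2)%:E))%E.
  have iF : P.-integrable setT F.
    apply/integrableP; split.
      by apply: ge0_emeasurable_sum => // k w _ _; exact: t0.
    under eq_integral do rewrite gee0_abs ?nneseries_ge0 //.
    rewrite integral_nneseries //.
    apply: (@le_lt_trans _ _ C%:E); last exact: ltry.
    apply: lime_le.
      by apply: is_cvg_nneseries => k _ _; apply: integral_ge0.
    apply: nearW => K; rewrite big_mkord.
    apply: (@le_trans _ _ (\sum_(k < K) lambda k * mdefect S M xi x0 lambda
      k)%:E); last by rewrite lee_fin.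
    rewrite -sumEFin; apply: lee_sum => k _.
    have mk : measurable_fun setT (fun w => (defect M (X k w) ^+ 2)%:E).
      by apply/measurable_EFinP; exact: measurable_funX.
    have k0 w : (0 <= (defect M (X k w) ^+ 2)%:E)%E by rewrite lee_fin sqr_ge0.
    by rewrite ge0_integralZl // ?lee_fin // E2 EFinM.
  apply: filterS2 (integrable_ae measurableT iF) rS => w /(_ I) Ffin rw;
    exists (fine (F w)) => K.
  rewrite -lee_fin fineK // -sumEFin.
  rewrite -(big_mkord xpredT (fun k => (lambda k * r k w ^+ 2)%:E)).
  under eq_bigr do rewrite rw EFinM.
  by apply: nneseries_lim_ge => k _ _; exact: t0.
Qed.
End Bounds.

(** * Series and asymptotics *)

Section Telescoping.
Context (R : realType).
Implicit Types (f g : nat -> R).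

Lemma sum_le_telescope f g m K : (m <= K)%N ->
  (forall k, (m <= k < K)%N -> f k <= g k.+1 - g k) ->
  \sum_(m <= k < K) f k <= g K - g m.
Proof. by move=> mK fg; rewrite -telescope_sumr // ler_sum_nat. Qed.

Lemma telescope_le_sum f g m K : (m <= K)%N ->
  (forall k, (m <= k < K)%N -> g k.+1 - g k <= f k) ->
  g K - g m <= \sum_(m <= k < K) f k.
Proof. by move=> mK fg; rewrite -telescope_sumr // ler_sum_nat. Qed.

Lemma ln_diff_le (x y : R) : 0 < x -> 0 < y -> ln x - ln y <= (x - y) / y.
Proof.
move=> x0 y0; rewrite -ln_div ?posrE //.
have -> : x / y = 1 + (x - y) / y by field; rewrite gt_eqF.
apply: le_ln1Dx; rewrite mulrBl divff ?gt_eqF // ltrBrDr addNr.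
by rewrite divr_gt0.
Qed.

Lemma ln_diff_ge (x y : R) : 0 < x -> 0 < y -> (x - y) / x <= ln x - ln y.
Proof.
move=> x0 y0; rewrite -lerN2 opprB -mulNr opprB; exact: ln_diff_le.
Qed.
End Telescoping.

Section Series.
Context (R : realType).

Lemma powRE (x s : R) : 0 < x -> x `^ s = expR (s * ln x).
Proof. by move=> x0; rewrite /powR gt_eqF. Qed.

Lemma ltr0S k : 0 < k.+1%:R :> R.
Proof. by rewrite ltr0n. Qed.

Lemma powR_series_le (s : R) K : 1 < s ->
  \sum_(k < K) k.+1%:R `^ (- s) <= 1 + (s - 1)^-1.
Proof.
move=> s1; have b0 : 0 < s - 1 by rewrite subr_gt0.
case: K => [|K]; first by rewrite big_ord0 addr_ge0 // invr_ge0 ltW.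
rewrite big_ord_recl powR1 lerD2l.
under eq_bigr do rewrite lift0.
rewrite -(big_mkord xpredT (fun k => k.+2%:R `^ (- s))).
pose g k : R := - (k.+1%:R `^ (1 - s) / (s - 1)).
have := @sum_le_telescope R (fun k => k.+2%:R `^ (- s)) g 0 K (leq0n K).
rewrite /g powR1 div1r opprK => /(_ _)/le_trans; apply; last first.
  by rewrite gerDr oppr_le0 divr_ge0 ?powR_ge0 ?ltW.
move=> k _.
rewrite opprK addrC -mulrBl ler_pdivlMr // !powRE //.
set u := k.+2%:R : R.
have u0 : 0 < u by exact: ltr0S.
have h1 : (u - k.+1%:R) / u <= ln u - ln k.+1%:R by apply: ln_diff_ge => //;
  exact: ltr0S.
have uk : u - k.+1%:R = 1 by rewrite /u -natrB // subSnn.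
rewrite uk div1r in h1.
have -> : (1 - s) * ln k.+1%:R = (1 - s) * ln u + (s - 1) * (ln u - ln k.+1%:R)
  by ring.
rewrite expRD -[X in _ <= _ - X]mulr1 -mulrBr.
have -> : - s * ln u = (1 - s) * ln u + (- ln u) by ring.
rewrite expRD expRN lnK ?posrE // -mulrA ler_wpM2l ?expR_ge0 // lerBrDl.
apply: le_trans (expR_ge1Dx _); rewrite lerD2l mulrC.
by apply: ler_wpM2l => //; exact: ltW.
Qed.

Lemma inv_sqr_tail_le m K : (m <= K)%N ->
  \sum_(m <= k < K) (k.+1%:R ^- 2 : R) <= 2 / m.+1%:R.
Proof.
(* The increment is [2 / (x (x + 1))], which dominates [1 / x^2] because [x >= 1]; this fixes the
   factor 2. *)
move=> mK; pose g k : R := - (2 / k.+1%:R).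
apply: (@le_trans _ _ (g K - g m)).
  apply: sum_le_telescope => // k _; rewrite /g opprK.
  have k0 : 0 < k.+1%:R :> R by exact: ltr0S.
  have -> : k.+2%:R = k.+1%:R + 1 :> R by rewrite -addn1 natrD.
  have k1 : 1 <= k.+1%:R :> R by rewrite ler1n.
  set x := k.+1%:R in k0 k1 *.
  have -> : - (2 / (x + 1)) + 2 / x = 2 / (x * (x + 1)).
    by field; rewrite !gt_eqF // addr_gt0.
  rewrite ler_pdivlMr ?mulr_gt0 ?addr_gt0 //.
  have -> : x ^- 2 * (x * (x + 1)) = (x + 1) / x by field; rewrite gt_eqF.
  by rewrite ler_pdivrMr //; lra.
by rewrite /g opprK gerDr oppr_le0 divr_ge0.
Qed.

Lemma harmonic_ge K : ln K.+1%:R <= \sum_(k < K) (k.+1%:R^-1 : R).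
Proof.
rewrite -(big_mkord xpredT (fun k => k.+1%:R^-1 : R)).
have := @telescope_le_sum R (fun k => k.+1%:R^-1) (fun k => ln k.+1%:R) 0 K
  (leq0n K).
rewrite ln1 subr0; apply => k _.
apply: le_trans (ln_diff_le (ltr0S _) (ltr0S _)) _.
by rewrite -natrB // subSnn div1r.
Qed.

Definition eln (k : nat) : R := ln (k%:R + expR 1).

Lemma e_ge2 : 2 <= expR 1 :> R.
Proof. by have := expR_ge1Dx (1 : R); lra. Qed.

Lemma e_gt0 k : 0 < k%:R + expR 1 :> R.
Proof. by rewrite ltr_wpDl // expR_gt0. Qed.

Lemma eln_ge1 k : 1 <= eln k.
Proof.
rewrite -{1}(expRK (1 : R)) ler_ln ?posrE ?expR_gt0 ?e_gt0 //.
by rewrite lerDr.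
Qed.

Lemma eln_gt0 k : 0 < eln k.
Proof. exact: lt_le_trans (eln_ge1 k). Qed.

Lemma elnS_le k : eln k.+1 <= 2 * eln k.
Proof.
rewrite /eln mulr_natl -lnXn ?e_gt0 // ler_ln ?posrE ?exprn_gt0 ?e_gt0 //.
have := e_ge2; have : 0 <= k%:R :> R by [].
rewrite -[k.+1]addn1 natrD; nra.
Qed.

Lemma log_series_le K :
  \sum_(k < K) (k.+1%:R^-1 * (eln k)^-1 ^+ 2 : R) <= 2 * (1 + expR 1).
Proof.
rewrite -(big_mkord xpredT (fun k => k.+1%:R^-1 * (eln k)^-1 ^+ 2 : R)).
(* Up to a constant, an antiderivative of [1 / (x ln(x)^2)]. The factor [1 + e] compares [k + 1]
   with [k + 1 + e], and the 2 comes from [eln k.+1 <= 2 * eln k]. *)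
pose g k : R := - (2 * (1 + expR 1) / eln k).
apply: (@le_trans _ _ (g K - g 0%N)); last first.
  have -> : g 0%N = - (2 * (1 + expR 1)).
    by rewrite /g /eln add0r expRK divr1.
  rewrite opprK gerDr oppr_le0; apply: divr_ge0; last exact/ltW/eln_gt0.
  by rewrite mulr_ge0 // addr_ge0 // expR_ge0.
apply: sum_le_telescope => // k _; rewrite /g opprK addrC -mulrBr.
have x0 := eln_gt0 k; have y0 := eln_gt0 k.+1.
have h := elnS_le k.
have d : (k.+1%:R + expR 1)^-1 <= eln k.+1 - eln k.
  have := ln_diff_ge (e_gt0 k.+1) (e_gt0 k).
  rewrite -/(eln k) -/(eln k.+1) (_ : _ - (k%:R + expR 1) = 1) ?div1r //.
  by rewrite -[k.+1]addn1 natrD; ring.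
have v : k.+1%:R^-1 <= (1 + expR 1) * (k.+1%:R + expR 1)^-1 :> R.
  rewrite ler_pdivlMr ?e_gt0 // mulrC ler_pdivrMr ?ltr0S //.
  have : 1 <= k.+1%:R :> R by rewrite ler1n.
  have := expR_gt0 (1 : R); nra.
have e1 : 0 <= 1 + expR 1 :> R by rewrite addr_ge0 // expR_ge0.
have v2 : k.+1%:R^-1 <= (1 + expR 1) * (eln k.+1 - eln k).
  by apply: le_trans v _; rewrite ler_wpM2l.
set x := eln k in x0 h v2 *; set y := eln k.+1 in y0 h v2 *.
have -> : 2 * (1 + expR 1) * (x^-1 - y^-1) =
   ((1 + expR 1) * (y - x)) * (2 / (x * y)).
  by field; rewrite !gt_eqF.
apply: ler_pM => //; first by rewrite exprn_ge0 // invr_ge0 ltW.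
rewrite ler_pdivlMr ?mulr_gt0 //.
have -> : x^-1 ^+ 2 * (x * y) = y / x by field; rewrite gt_eqF.
by rewrite ler_pdivrMr.
Qed.

Lemma log_harmonic_ge K : ln (eln K) <= \sum_(k < K) (k.+1%:R^-1 * (eln k)^-1 :
  R).
Proof.
rewrite -(big_mkord xpredT (fun k => k.+1%:R^-1 * (eln k)^-1 : R)).
have := @telescope_le_sum R (fun k => k.+1%:R^-1 * (eln k)^-1) (fun k => ln
  (eln k)) 0 K (leq0n K).
have -> : eln 0 = 1 by rewrite /eln add0r expRK.
rewrite ln1 subr0; apply => k _.
apply: le_trans (ln_diff_le (eln_gt0 _) (eln_gt0 _)) _.
rewrite ler_wpM2r ?invr_ge0 ?(ltW (eln_gt0 _)) //.
apply: le_trans (ln_diff_le (e_gt0 _) (e_gt0 _)) _.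
rewrite (_ : _ - (k%:R + expR 1) = 1) ?div1r; last first.
  by rewrite -[k.+1]addn1 natrD; ring.
rewrite lef_pV2 ?posrE ?e_gt0 ?ltr0S // -[k.+1]addn1 natrD lerD2l.
by have := e_ge2; lra.
Qed.
End Series.

(** * Asymptotic notation *)

Section Asymptotics.
Context (R : realType).

(** Finiteness is required from [n0] on, but the rate may be usable only for large [K]; hence two
    separate bounds. *)
Lemma expectation_bigO_intro n0 (u : nat -> \bar R) (rate : nat -> R) :
  (forall K, 0 <= u K)%E ->
  (forall K, (n0 <= K)%N -> exists B, (u K <= B%:E)%E) ->
  (exists C, \forall K \near \oo, 0 <= rate K /\ (u K <= (C * rate K)%:E)%E) ->
  expectation_bigO n0 u rate.
Proof.
move=> u0 uB [C HC]; split=> [K /uB[B uKB]|].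
  by rewrite ge0_fin_numE // (le_lt_trans uKB) // ltry.
apply/eqO_exP; exists (`|C| + 1); first by rewrite ltr_wpDl.
apply: filterS HC => K [rK uK].
have uf : u K \is a fin_num by rewrite ge0_fin_numE // (le_lt_trans uK) // ltry.
rewrite [X in X <= _]ger0_norm ?fine_ge0 // (ger0_norm rK) -lee_fin fineK //.
apply: le_trans uK _; rewrite lee_fin ler_wpM2r //.
by rewrite (le_trans (ler_norm C)) // lerDl.
Qed.

Lemma near_ge (n : nat) : \forall K \near \oo, (n <= K)%N.
Proof. by exists n. Qed.

Lemma near_ln_ge (A : R) : \forall K \near \oo, A <= ln K%:R.
Proof.
near=> K.
have AK : expR A <= K%:R.
  apply: (@le_trans _ _ (Num.trunc (expR A)).+1%:R).
    by apply/ltW; apply: truncnS_gt.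
  by rewrite ler_nat; near: K; exact: near_ge.
by rewrite -(expRK A) ler_ln ?posrE ?expR_gt0 // (lt_le_trans _ AK) // expR_gt0.
Unshelve. all: by end_near. Qed.

(** The squared minimum times the parameter sum over a tail [[M, K)] is at most the tail of a
    convergent series, which is arbitrarily small. Divergence of the parameter sums makes the part
    before [M] negligible, which improves O to o. *)
Lemma min_sum_littleo (r lam rate : nat -> R) (B c : R) : 0 < c ->
  (forall k, 0 <= r k) -> (forall k, 0 <= lam k) ->
  (forall K, \sum_(k < K) lam k * r k ^+ 2 <= B) ->
  (forall A, \forall K \near \oo, A <= \sum_(k < K) lam k) ->
  (\forall K \near \oo, 0 <= rate K /\ c <= rate K ^+ 2 * \sum_(k < K) lam k) ->
  (fun K => \big[Num.min/r 0]_(k < K) r k : R^o) =o_\oo (rate : nat -> R^o).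
Proof.
move=> c0 r0 lam0 sB Sy rateS; apply/eqoP => eps eps0.
pose s K := \sum_(k < K) lam k * r k ^+ 2.
have hs : has_sup (range s).
  by split; [exists (s 0%N), 0%N|exists B => _ [K _ <-]; exact: sB].
(* For large [K], [S <= 2 (S - SM)], so a tail at most [eta] gives [mn^2 S <= 2 eta = eps^2 c], and
   [c <= rate^2 S] concludes. *)
pose eta := eps ^+ 2 * c / 2.
have eta0 : 0 < eta by rewrite divr_gt0 // mulr_gt0 // exprn_gt0.
have [_ [M _ <-] sM] := sup_adherent eta0 hs.
pose SM := \sum_(k < M) lam k.
near=> K.
have [rK cK] : 0 <= rate K /\ c <= rate K ^+ 2 * \sum_(k < K) lam k by near: K.
have MK : (M <= K)%N by near: K; exact: near_ge.
have K0 : (0 < K)%N by near: K; exact: near_ge.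
have S2 : 2 * SM + 1 <= \sum_(k < K) lam k by near: K; exact: Sy.
set S := \sum_(k < K) lam k in cK S2.
set mn := \big[Num.min/r 0]_(k < K) r k.
have mn_le k : (k < K)%N -> mn <= r k.
  by move=> kK; exact: (bigmin_le _ (Ordinal kK)).
have mn0 : 0 <= mn by apply: le_bigmin.
rewrite !ger0_norm //.
have tail : mn ^+ 2 * (S - SM) <= eta.
  have -> : S - SM = \sum_(M <= k < K) lam k.
    rewrite /S /SM -!(big_mkord xpredT lam) (@big_cat_nat _ _ _ M 0 K) //=.
    by rewrite addrAC subrr add0r.
  apply: (@le_trans _ _ (\sum_(M <= k < K) lam k * r k ^+ 2)).
    rewrite mulr_sumr ler_sum_nat // => k /andP[_ kK].
    by rewrite mulrC ler_wpM2l // lerXn2r ?nnegrE // mn_le.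
  have -> : \sum_(M <= k < K) lam k * r k ^+ 2 = s K - s M.
    rewrite /s -!(big_mkord xpredT (fun k => lam k * r k ^+ 2)).
    by rewrite (@big_cat_nat _ _ _ M 0 K) //= addrAC subrr add0r.
  have : s K <= sup (range s) by apply: sup_upper_bound => //; exists K.
  move: sM; rewrite ltrBlDr; lra.
have SM0 : 0 <= SM by exact: sumr_ge0.
have S0 : 0 < S by lra.
rewrite -(@ler_pXn2r _ 2) ?nnegrE ?mulr_ge0 ?(ltW eps0) //.
rewrite -(ler_pM2r S0) exprMn -[leRHS]mulrA.
have h1 : mn ^+ 2 * S <= 2 * eta.
  have : mn ^+ 2 * (S / 2) <= mn ^+ 2 * (S - SM).
    by rewrite ler_wpM2l ?sqr_ge0 //; lra.
  lra.
apply: (le_trans h1); have : eps ^+ 2 * c <= eps ^+ 2 * (rate K ^+ 2 * S).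
  by rewrite ler_wpM2l ?sqr_ge0.
by rewrite /eta; lra.
Unshelve. all: by end_near. Qed.
End Asymptotics.

(** * From parameter sums to rates *)

Section Rates.
Context (R : realType) (H : completeNormedModType R) (dot : {dot H for idfun})
        (norm_dot : forall x : H, dot x x = `|x| ^+ 2) (sepH : separable H).
Context (dX : measure_display) (Xi : measurableType dX) (D : probability Xi R)
        (T : Xi -> H -> H)
        (T1 : {ae D, forall s, nonexpansive (T s)})
        (mT : forall x, borel_measurable (fun s => T s x))
        (iT : forall x, bochner_integrable D (fun s => T s x)).
Let M := mean_operator D T.
Context (sigma : R) (p : H) (Mp : M p = p)
        (varp : (\int[D]_s (`|T s p - M p| ^+ 2)%:E <= (sigma ^+ 2)%:E)%E).
Context (dO : measure_display) (Omega : measurableType dO)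
        (P : probability Omega R) (x0 : H)
        (delta : R) (delta_gt0 : 0 < delta) (Q : R).

Let E0 := energy_bound sigma delta (`|x0 - p| ^+ 2) Q.
Let W0 := noise_sup sigma (`|x0 - p| ^+ 2) Q.

(** Young's inequality at scale [rate] bounds a first moment by [(rate + V / rate) / 2]. Once the
    second moment [V] is at most [A rate^2], this is [(1 + A) / 2] times the rate, the form of both
    constants. *)
Definition index_const (c1 : R) := (1 + E0 / (delta * expR (- (2 * Q))) / c1) / 2.
Definition last_const (c1 c2 : R) := (1 + (2 * E0 / c1 + 8 * W0 * c2)) / 2.

Let E0_ge0 : 0 <= Q -> 0 <= E0.
Proof.
move=> Q0; rewrite /E0 /energy_bound divr_ge0 ?(ltW delta_gt0) //.
have d0 : 0 <= dist_bound sigma (`|x0 - p| ^+ 2) Q.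
  by rewrite mulr_ge0 ?expR_ge0 // addr_ge0 ?sqr_ge0 // mulr_ge0 // mulr_ge0
    ?sqr_ge0.
rewrite addr_ge0 ?sqr_ge0 // mulr_ge0 // addr_ge0 //; first by rewrite mulr_ge0.
by rewrite mulr_ge0 ?sqr_ge0.
Qed.

Let W0_ge0 : 0 <= Q -> 0 <= W0.
Proof.
move=> Q0; rewrite /W0 /noise_sup.
have d0 : 0 <= dist_bound sigma (`|x0 - p| ^+ 2) Q.
  by rewrite mulr_ge0 ?expR_ge0 // addr_ge0 ?sqr_ge0 // mulr_ge0 // mulr_ge0
    ?sqr_ge0.
by rewrite addr_ge0 //; rewrite mulr_ge0 ?sqr_ge0.
Qed.

Context (xi : nat -> {RV P >-> Xi}) (iid : iid_from D xi) (lambda : nat -> R)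
        (l0 : forall k, 0 <= lambda k) (ld : forall k, delta <= 1 - lambda k).
Let r := residual D T lambda x0 xi.

Lemma index_rate K (N : {RV P >-> nat}) (rate c1 : R) :
  \sum_(k < K) lambda k ^+ 2 <= Q -> random_index P lambda xi K N ->
  0 < rate -> 0 < c1 -> c1 <= rate ^+ 2 * \sum_(k < K) lambda k ->
  ('E_P[fun w => r (N w) w] <= (index_const c1 * rate)%:E)%E.
Proof.
move=> lQ NK r0 c10 c1S.
have Q0 : 0 <= Q by apply: le_trans lQ; apply: sumr_ge0 => k _; exact: sqr_ge0.
have S0 : 0 < \sum_(k < K) lambda k.
  by rewrite -(pmulr_rgt0 _ (exprn_gt0 2 r0)) (lt_le_trans c10).
have [m [rho [[m0 mge rge mrec rle] [_ EN _]]]] :=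
  moment_sequences norm_dot sepH T1 mT iT Mp varp iid x0 delta_gt0 l0 ld.
apply: le_trans (EN K N rate NK r0) _.
have := index_weight_mean_le mge rge l0 delta_gt0 ld mrec lQ S0.
rewrite m0 -/E0; set A := E0 / _ => h.
have A0 : 0 <= A by rewrite divr_ge0 ?E0_ge0 // mulr_ge0 ?expR_ge0 // ltW.
set V := (X in X / rate); rewrite -/V in h.
have hV : V <= A / c1 * rate ^+ 2.
  apply: (le_trans h); rewrite -mulrA ler_wpM2l // mulrC.
  by rewrite ler_pdivlMr // mulrC ler_pdivrMr.
rewrite lee_fin /index_const -/A mulrAC ler_wpM2r // mulrDl mul1r lerD2l.
by rewrite ler_pdivrMr // -mulrA -expr2.
Qed.

Lemma last_rate K m' (rate c1 c2 : R) :
  \sum_(k < K) lambda k ^+ 2 <= Q -> (m' <= K)%N ->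
  0 < rate -> 0 < c1 -> c1 <= rate ^+ 2 * \sum_(m' <= k < K) lambda k ->
  \sum_(m' <= k < K) lambda k ^+ 2 <= c2 * rate ^+ 2 ->
  ('E_P[r K] <= (last_const c1 c2 * rate)%:E)%E.
Proof.
move=> lQ mK r0 c10 c1S c2S.
have Q0 : 0 <= Q by apply: le_trans lQ; apply: sumr_ge0 => k _; exact: sqr_ge0.
have S0 : 0 < \sum_(m' <= k < K) lambda k.
  by rewrite -(pmulr_rgt0 _ (exprn_gt0 2 r0)) (lt_le_trans c10).
have [m [rho [[m0 mge rge mrec rle] [EK _ _]]]] :=
  moment_sequences norm_dot sepH T1 mT iT Mp varp iid x0 delta_gt0 l0 ld.
apply: le_trans (EK K rate r0) _.
have := last_le mge rge l0 delta_gt0 ld mrec rle lQ mK.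
rewrite m0 -/E0 -/W0; set S := \sum_(m' <= k < K) lambda k in S0 c1S *.
move=> h; rewrite lee_fin /last_const mulrAC ler_wpM2r // mulrDl mul1r lerD2l.
rewrite ler_pdivrMr // -[leRHS]mulrA -expr2 mulrDl.
rewrite -(ler_pM2l S0); apply: (le_trans h); rewrite [leRHS]mulrDr; apply: lerD.
  have h1 : 1 <= S * rate ^+ 2 / c1 by rewrite ler_pdivlMr // mul1r mulrC.
  have -> : S * (2 * E0 / c1 * rate ^+ 2) = 2 * E0 * (S * rate ^+ 2 / c1) by ring.
  by apply: ler_peMr => //; rewrite mulr_ge0 // E0_ge0.
rewrite [leLHS]mulrC; apply: ler_wpM2l; first exact: ltW.
rewrite -[leRHS]mulrA; apply: ler_wpM2l => //; rewrite mulr_ge0 //.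
exact: W0_ge0.
Qed.

Lemma min_rate (rate : nat -> R) (c1 : R) :
  (forall K, \sum_(k < K) lambda k ^+ 2 <= Q) -> 0 < c1 ->
  (forall A, \forall K \near \oo, A <= \sum_(k < K) lambda k) ->
  (\forall K \near \oo, 0 <= rate K /\ c1 <= rate K ^+ 2 * \sum_(k < K) lambda
    k) ->
  almost_surely_littleo P (min_residual D T lambda x0 xi) rate.
Proof.
move=> lQ c10 Sy rateS.
have [m [rho [[m0 mge rge mrec rle] [_ _ as_]]]] :=
  moment_sequences norm_dot sepH T1 mT iT Mp varp iid x0 delta_gt0 l0 ld.
have /as_ : forall K, \sum_(k < K) lambda k * rho k <= energy_bound sigma delta
  (m 0) Q.
  by move=> K; exact: (energy_le mge rge l0 delta_gt0 ld mrec (lQ K)).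
apply: filterS => w [B HB].
apply: (min_sum_littleo (r := fun k => r k w) c10 _ l0 HB Sy rateS) => k.
exact: normr_ge0.
Qed.
End Rates.

(** * Relaxation schedules *)

Section Schedules.
Context (R : realType) (lb : R) (lb0 : 0 < lb) (lb1 : lb < 1).
Implicit Types (a : R) (k K m : nat).

Lemma sqr_powR (x s : R) : (x `^ s) ^+ 2 = x `^ (s * 2).
Proof. by rewrite -powR_mulrn ?powR_ge0 // -powRrM. Qed.

Lemma sqr_powR_half (x e : R) : (x `^ (- (e / 2))) ^+ 2 = x `^ (- e).
Proof. by rewrite sqr_powR; congr (_ `^ _); field. Qed.

Lemma powRN_le (x y s : R) : 0 < x -> x <= y -> 0 <= s -> y `^ (- s) <= x `^ (-
  s).
Proof.
move=> x0 xy s0; have y0 : 0 < y by exact: lt_le_trans xy.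
rewrite !powRN lef_pV2 ?posrE ?powR_gt0 //.
by apply: ge0_ler_powR; rewrite ?nnegrE ?(ltW x0) ?(ltW y0).
Qed.

Definition pow_schedule a k : R := lb * k.+1%:R `^ (- a).

Lemma powR_inv_le1 a k : 0 <= a -> k.+1%:R `^ (- a) <= 1 :> R.
Proof.
move=> a0; rewrite -[leRHS](powRr0 (k.+1%:R : R)) ler_powR //.
  by rewrite ler1n.
by rewrite oppr_le0.
Qed.

Lemma pow_schedule_gt0 a k : 0 < pow_schedule a k.
Proof. by rewrite mulr_gt0 // powR_gt0. Qed.

Lemma pow_schedule_le a k : 0 <= a -> pow_schedule a k <= lb.
Proof. by move=> a0; rewrite /pow_schedule ler_piMr ?(ltW lb0) // powR_inv_le1.
  Qed.

Lemma lb_sqr_le1 : lb ^+ 2 <= 1.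
Proof. by rewrite exprn_ile1 // ltW. Qed.

Lemma pow_schedule_sqr_le a k : pow_schedule a k ^+ 2 <= k.+1%:R `^ (- (2 * a)).
Proof.
rewrite /pow_schedule exprMn sqr_powR (_ : - a * 2 = - (2 * a)); last by ring.
by rewrite ler_piMl ?powR_ge0 // lb_sqr_le1.
Qed.

Lemma pow_schedule_sqr_sum a K : 1 / 2 < a ->
  \sum_(k < K) pow_schedule a k ^+ 2 <= 1 + (2 * a - 1)^-1.
Proof.
move=> a12; apply: le_trans (powR_series_le K _); last by lra.
by apply: ler_sum => k _; exact: pow_schedule_sqr_le.
Qed.

Lemma pow_schedule_sum_ge a m K : 0 <= a -> (m <= K)%N ->
  lb * (K - m)%:R * K%:R `^ (- a) <= \sum_(m <= k < K) pow_schedule a k.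
Proof.
move=> a0 mK.
have -> : lb * (K - m)%:R * K%:R `^ (- a) = \sum_(m <= k < K) lb * K%:R `^ (- a).
  by rewrite sumr_const_nat -mulr_natr; ring.
rewrite ler_sum_nat // => k /andP[_ kK];
  rewrite /pow_schedule ler_wpM2l ?(ltW lb0) //.
by apply: powRN_le; rewrite ?ltr0n ?ler_nat.
Qed.

Lemma powR_1B a K : (0 < K)%N -> K%:R * K%:R `^ (- a) = K%:R `^ (1 - a) :> R.
Proof.
move=> K0; rewrite powRD; last by apply/implyP => _; rewrite pnatr_eq0 -lt0n.
by rewrite powRr1.
Qed.

Lemma powRM_N a K : (0 < K)%N -> K%:R `^ (- a) * K%:R `^ a = 1 :> R.
Proof.
move=> K0; have x0 : 0 < K%:R `^ a :> R by rewrite powR_gt0 // ltr0n.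
by rewrite powRN mulVf // lt0r_neq0.
Qed.

Lemma pow_schedule_sum_ge0 a K : 0 <= a -> (0 < K)%N ->
  lb * K%:R `^ (1 - a) <= \sum_(k < K) pow_schedule a k.
Proof.
move=> a0 K0; rewrite -powR_1B // mulrA -{1}(subn0 K).
by rewrite -(big_mkord xpredT (pow_schedule a)) pow_schedule_sum_ge.
Qed.

Lemma half_window_sum_ge a K : 0 <= a -> (0 < K)%N ->
  lb / 2 * K%:R `^ (1 - a) <= \sum_(K./2 <= k < K) pow_schedule a k.
Proof.
move=> a0 K0; have hK : (K./2 <= K)%N by rewrite -{2}(odd_double_half K) -addnn
  addnA leq_addl.
apply: le_trans (pow_schedule_sum_ge a0 hK).
rewrite -powR_1B // mulrA ler_wpM2r ?powR_ge0 // -mulrA ler_wpM2l ?(ltW lb0) //.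
have h : K%:R = (K./2)%:R + (K - K./2)%:R :> R by rewrite -natrD subnKC.
have : (K./2)%:R <= (K - K./2)%:R :> R.
  rewrite ler_nat leq_subRL // addnn -{2}(odd_double_half K); exact: leq_addl.
by rewrite mulrC; lra.
Qed.

Lemma half_window_sqr_sum_le a K : 0 <= a -> a <= 1 -> (0 < K)%N ->
  \sum_(K./2 <= k < K) pow_schedule a k ^+ 2 <= 4 * K%:R `^ (- (2 * a - 1)).
Proof.
move=> a0 a1 K0.
have K0' : 0 < K%:R :> R by rewrite ltr0n.
have k4 k : (K./2 <= k)%N -> k.+1%:R `^ (- (2 * a)) <= 4 * K%:R `^ (- (2 * a))
  :> R.
  move=> hk; have Kk : (K <= 2 * k.+1)%N.
    rewrite mul2n -{1}(odd_double_half K) doubleS addnC.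
    rewrite -addn2 leq_add ?leq_double //; exact: leq_trans (leq_b1 _) _.
  have h1 : (2 * k.+1%:R) `^ (- (2 * a)) <= K%:R `^ (- (2 * a)) :> R.
    by apply: powRN_le; rewrite ?mulr_ge0 // -natrM ler_nat.
  (* In the window [k + 1 >= K / 2], so the loss is [2^(2a)], at most 4 since [a <= 1]. *)
  have h2 : 4^-1 <= 2 `^ (- (2 * a)) :> R.
    have -> : 4^-1 = 2 `^ (- 2%:R) :> R by rewrite powRN powR_mulrn //;
      congr (_^-1); ring.
    by apply: ler_powR; rewrite ?ler1n //; lra.
  rewrite powRM // in h1.
  have := ler_wpM2r (powR_ge0 k.+1%:R (- (2 * a))) h2; lra.
have hK : (K - K./2)%:R <= K%:R :> R by rewrite ler_nat leq_subr.
apply: (@le_trans _ _ (\sum_(K./2 <= k < K) (4 * K%:R `^ (- (2 * a))))).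
  rewrite ler_sum_nat // => k /andP[hk _].
  by apply: le_trans (pow_schedule_sqr_le _ _) _; exact: k4.
rewrite sumr_const_nat -[leLHS]mulr_natr.
have -> : K%:R `^ (- (2 * a - 1)) = K%:R `^ (- (2 * a)) * K%:R :> R.
  by rewrite opprB -powR_1B // mulrC.
by rewrite [leRHS]mulrA; apply: ler_wpM2l => //; rewrite mulr_ge0 ?powR_ge0.
Qed.

(** The first [m] harmonic terms are bounded crudely by 1 each; this is enough because [m] will be
    at most [(ln K) / 2]. *)
Lemma inv_schedule_window_ge m K : (m <= K)%N ->
  lb * (ln K%:R - m%:R) <= \sum_(m <= k < K) pow_schedule 1 k.
Proof.
move=> mK; rewrite /pow_schedule -mulr_sumr ler_wpM2l ?(ltW lb0) //.
under eq_bigr do rewrite powR_inv1 //.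
have h := harmonic_ge R K.
have lnK : ln K%:R <= ln K.+1%:R :> R.
  have [->|K0] := posnP K; first by rewrite ln0 // ln1.
  by rewrite ler_ln ?posrE ?ltr0n // ler_nat.
rewrite -(big_mkord xpredT (fun k => k.+1%:R^-1)) (@big_cat_nat _ _ _ m 0 K)
  //= in h.
have hm : \sum_(0 <= k < m) k.+1%:R^-1 <= m%:R :> R.
  apply: (@le_trans _ _ (\sum_(0 <= k < m) 1)).
    by apply: ler_sum => k _; rewrite invf_le1 ?ltr0n // ler1n.
  by rewrite sumr_const_nat subn0.
lra.
Qed.

Lemma inv_schedule_sqr_window_le m K : (m <= K)%N ->
  \sum_(m <= k < K) pow_schedule 1 k ^+ 2 <= 2 / m.+1%:R.
Proof.
move=> mK; apply: le_trans (inv_sqr_tail_le R mK).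
apply: ler_sum => k _; rewrite /pow_schedule powR_inv1 // exprMn exprVn.
by rewrite ler_piMl ?lb_sqr_le1 // invr_ge0 exprn_ge0.
Qed.

Definition log_schedule a k : R := lb * k.+1%:R `^ (- a) * (eln R k)^-1.

Lemma log_schedule_gt0 a k : 0 < log_schedule a k.
Proof. by rewrite mulr_gt0 ?invr_gt0 ?eln_gt0 // pow_schedule_gt0. Qed.

Lemma log_schedule_le a k : 0 <= a -> log_schedule a k <= lb.
Proof.
move=> a0; rewrite /log_schedule -/(pow_schedule a k).
rewrite ler_pdivrMr ?eln_gt0 // (le_trans (pow_schedule_le k a0)) //.
by rewrite ler_peMr ?eln_ge1 // ltW.
Qed.

(** Even at [a = 1/2] the squares are at most [1 / ((k + 1) ln(k + e)^2)], which is summable: the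
    logarithm is what admits this endpoint. *)
Lemma log_schedule_sqr_sum a K : 1 / 2 <= a ->
  \sum_(k < K) log_schedule a k ^+ 2 <= 2 * (1 + expR 1).
Proof.
move=> a12; apply: le_trans (log_series_le R K); apply: ler_sum => k _.
rewrite /log_schedule exprMn ler_wpM2r ?sqr_ge0 //.
apply: le_trans (pow_schedule_sqr_le a k) _.
rewrite -powR_inv1 // ler_powR ?ler1n //; lra.
Qed.

Lemma log_schedule_sum_ge a K : 0 <= a -> (0 < K)%N ->
  lb * K%:R `^ (1 - a) / eln R K <= \sum_(k < K) log_schedule a k.
Proof.
move=> a0 K0.
apply: (@le_trans _ _ ((\sum_(k < K) pow_schedule a k) / eln R K)).
  by rewrite ler_wpM2r ?invr_ge0 ?(ltW (eln_gt0 _ _)) // pow_schedule_sum_ge0.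
rewrite mulr_suml; apply: ler_sum => k _; rewrite /log_schedule.
rewrite ler_wpM2l ?(ltW (pow_schedule_gt0 _ _)) // lef_pV2 ?posrE ?eln_gt0 //.
by rewrite ler_ln ?posrE ?e_gt0 // lerD2r ler_nat ltnW.
Qed.

Lemma eln_le_ln : \forall K \near \oo, eln R K <= 2 * ln K%:R.
Proof.
near=> K.
have K0 : (0 < K)%N by near: K; exact: near_ge.
have eK : expR 1 <= K%:R :> R.
  have h : 1 <= ln K%:R :> R by near: K; exact: near_ln_ge.
  by rewrite -(@lnK _ K%:R) ?posrE ?ltr0n // ler_expR.
have e2 := e_ge2 R.
rewrite mulr_natl -lnXn ?ltr0n // /eln ler_ln ?posrE ?e_gt0 ?exprn_gt0 ?ltr0n //.
nra.
Unshelve. all: by end_near. Qed.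

Lemma log_inv_schedule_sum_ge K : (0 < K)%N -> 0 < ln K%:R :> R ->
  lb * ln (ln K%:R) <= \sum_(k < K) log_schedule 1 k.
Proof.
move=> K0 lK; rewrite /log_schedule.
under eq_bigr do rewrite powR_inv1 // -mulrA.
rewrite -mulr_sumr ler_wpM2l ?(ltW lb0) //.
apply: le_trans (log_harmonic_ge R K).
rewrite ler_ln ?posrE ?eln_gt0 // /eln ler_ln ?posrE ?e_gt0 ?ltr0n //.
by rewrite lerDl expR_ge0.
Qed.

Lemma near_powR_ge (b A : R) : 0 < b -> \forall K \near \oo, A <= K%:R `^ b.
Proof.
move=> b0; near=> K.
have K0 : (0 < K)%N by near: K; exact: near_ge.
have : A / b <= ln K%:R by near: K; exact: near_ln_ge.
rewrite ler_pdivrMr // mulrC powRE ?ltr0n // => h.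
apply: le_trans h _; apply: le_trans (expR_ge1Dx _); lra.
Unshelve. all: by end_near. Qed.

Lemma near_powR_ln_ge (b A : R) : 0 < b ->
  \forall K \near \oo, A <= K%:R `^ b / ln K%:R.
Proof.
move=> b0; near=> K.
have K0 : (0 < K)%N by near: K; exact: near_ge.
have l1 : 1 <= ln K%:R :> R by near: K; exact: near_ln_ge.
have : 2 * A / b ^+ 2 <= ln K%:R by near: K; exact: near_ln_ge.
rewrite ler_pdivrMr ?exprn_gt0 // => h.
rewrite ler_pdivlMr ?(lt_le_trans ltr01) // powRE ?ltr0n //.
have bl : 0 <= b * ln K%:R by rewrite mulr_ge0 ?(ltW b0) // (le_trans ler01).
(* The quadratic term of the exponential is needed to beat the factor [ln K]. *)
apply: le_trans (expR_ge1Dxn 1 bl).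
have -> : (1.+1)`!%:R = 2 :> R by [].
rewrite exprMn.
have := ler_wpM2r (le_trans ler01 l1) h; lra.
Unshelve. all: by end_near. Qed.

Lemma near_lnln_ge (A : R) : \forall K \near \oo, A <= ln (ln K%:R).
Proof.
near=> K; have h : expR A <= ln K%:R by near: K; exact: near_ln_ge.
by rewrite -(expRK A) ler_ln ?posrE ?expR_gt0 // (lt_le_trans (expR_gt0 A)).
Unshelve. all: by end_near. Qed.
End Schedules.

(** * A schedule independent of the horizon *)

Section FixedSchedule.
Context (R : realType) (H : completeNormedModType R) (dot : {dot H for idfun})
        (norm_dot : forall x : H, dot x x = `|x| ^+ 2) (sepH : separable H).
Context (dX : measure_display) (Xi : measurableType dX) (D : probability Xi R)
        (T : Xi -> H -> H)
        (T1 : {ae D, forall s, nonexpansive (T s)})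
        (mT : forall x, borel_measurable (fun s => T s x))
        (iT : forall x, bochner_integrable D (fun s => T s x)).
Context (sigma : R) (p : H) (Mp : mean_operator D T p = p)
        (varp : (\int[D]_s (`|T s p - mean_operator D T p| ^+ 2)%:E <=
                 (sigma ^+ 2)%:E)%E).
Context (dO : measure_display) (Omega : measurableType dO)
        (P : probability Omega R) (x0 : H)
        (lb : R) (lb0 : 0 < lb) (lb1 : lb < 1).

Let delta_gt0 : 0 < 1 - lb. Proof. by rewrite subr_gt0. Qed.

Context (xi : nat -> {RV P >-> Xi}) (iid : iid_from D xi) (lambda : nat -> R)
        (l0 : forall k, 0 < lambda k) (l1 : forall k, lambda k <= lb)
        (Q : R) (lQ : forall K, \sum_(k < K) lambda k ^+ 2 <= Q).

Let lge0 k : 0 <= lambda k. Proof. exact: ltW. Qed.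
Let ld k : 1 - lb <= 1 - lambda k. Proof. by rewrite lerD2l lerN2. Qed.

Let sum_gt0 K : (0 < K)%N -> 0 < \sum_(k < K) lambda k.
Proof.
by case: K => // K _; rewrite big_ord_recl ltr_pwDl // sumr_ge0.
Qed.

Lemma index_bigO n0 (N : nat -> {RV P >-> nat}) (rate : nat -> R) (c1 : R) :
  (0 < n0)%N -> (forall K, (n0 <= K)%N -> random_index P lambda xi K (N K)) ->
  0 < c1 ->
  (\forall K \near \oo, 0 < rate K /\ c1 <= rate K ^+ 2 * \sum_(k < K) lambda
    k) ->
  expectation_bigO n0
    (fun K => 'E_P[fun w => residual D T lambda x0 xi (N K w) w]%E) rate.
Proof.
move=> n00 NK c10 rateS; apply: expectation_bigO_intro => [K|K nK|].
- by apply: expectation_ge0 => w; exact: normr_ge0.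
(* Finiteness for every [K] is obtained at scale 1, with the parameter sum itself as the constant:
   the target rate can vanish for small [K], for instance when [ln K = 0]. *)
- have S0 := sum_gt0 (leq_trans n00 nK); eexists.
  apply: (index_rate norm_dot sepH T1 mT iT Mp varp x0 delta_gt0 iid lge0 ld
    (lQ K) (NK K nK) ltr01 S0).
  by rewrite expr1n mul1r.
- eexists; apply: filterS2 (near_ge n0) rateS => K nK [rK cK].
  split; first exact: ltW.
  exact: (index_rate norm_dot sepH T1 mT iT Mp varp x0 delta_gt0 iid lge0 ld
    (lQ K) (NK K nK) rK c10 cK).
Qed.

Lemma last_bigO (m' : nat -> nat) (rate : nat -> R) (c1 c2 : R) : 0 < c1 ->
  (\forall K \near \oo, [/\ (m' K <= K)%N, 0 < rate K,
     c1 <= rate K ^+ 2 * \sum_(m' K <= k < K) lambda k &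
     \sum_(m' K <= k < K) lambda k ^+ 2 <= c2 * rate K ^+ 2]) ->
  expectation_bigO 1 (fun K => 'E_P[residual D T lambda x0 xi K]%E) rate.
Proof.
move=> c10 rateS; apply: expectation_bigO_intro => [K|K nK|].
- by apply: expectation_ge0 => w; exact: normr_ge0.
(* Again scale 1, now with the window starting at 0. *)
- have S0 := sum_gt0 nK; eexists.
  apply: (last_rate norm_dot sepH T1 mT iT Mp varp x0 delta_gt0 iid lge0 ld
    (lQ K) (leq0n K) ltr01 S0).
    by rewrite expr1n mul1r big_mkord.
  by rewrite expr1n mulr1 big_mkord; exact: lQ.
- eexists; apply: filterS rateS => K [mK rK cK c2K].
  split; first exact: ltW.
  exact: (last_rate norm_dot sepH T1 mT iT Mp varp x0 delta_gt0 iid lge0 ld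
    (lQ K) mK rK c10 cK c2K).
Qed.

Lemma min_littleo (rate : nat -> R) (c1 : R) : 0 < c1 ->
  (forall A, \forall K \near \oo, A <= \sum_(k < K) lambda k) ->
  (\forall K \near \oo, 0 < rate K /\ c1 <= rate K ^+ 2 * \sum_(k < K) lambda
    k) ->
  almost_surely_littleo P (min_residual D T lambda x0 xi) rate.
Proof.
move=> c10 Sy rateS.
apply: (min_rate norm_dot sepH T1 mT iT Mp varp x0 delta_gt0 iid lge0 ld lQ c10
  Sy).
by apply: filterS rateS => K [/ltW].
Qed.

End FixedSchedule.

(** * Rates for the decreasing schedules *)

Section ScheduleRates.
Context (R : realType) (lb : R) (lb0 : 0 < lb) (lb1 : lb < 1).

Lemma pow_rate (a : R) : 0 <= a -> \forall K \near \oo,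
  0 < K%:R `^ (- ((1 - a) / 2)) :> R /\
  lb <= (K%:R `^ (- ((1 - a) / 2))) ^+ 2 * \sum_(k < K) pow_schedule lb a k.
Proof.
move=> a0; near=> K; have K0 : (0 < K)%N by near: K; exact: near_ge.
split; first by rewrite powR_gt0 // ltr0n.
rewrite sqr_powR_half.
apply: le_trans (ler_wpM2l (powR_ge0 _ _) (pow_schedule_sum_ge0 lb0 a0 K0)).
by rewrite mulrCA powRM_N // mulr1.
Unshelve. all: by end_near. Qed.

Lemma pow_schedule_diverges (a A : R) : 0 <= a -> a < 1 ->
  \forall K \near \oo, A <= \sum_(k < K) pow_schedule lb a k.
Proof.
move=> a0 a1; near=> K; have K0 : (0 < K)%N by near: K; exact: near_ge.
apply: le_trans (pow_schedule_sum_ge0 lb0 a0 K0).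
rewrite mulrC -ler_pdivrMr //; near: K; apply: near_powR_ge.
by rewrite subr_gt0.
Unshelve. all: by end_near. Qed.

(** Two terms compete: the inverse parameter sum, of order [K^(-(1-a))], and the accumulated noise,
    of order [K^(-(2a-1))]. They balance at [a = 2/3], which explains the change of regime. *)
Lemma pow_last_rate (a : R) (rate : nat -> R) : 0 <= a -> a <= 1 ->
  (\forall K \near \oo, [/\ 0 < rate K, K%:R `^ (- (1 - a)) <= rate K ^+ 2 &
     K%:R `^ (- (2 * a - 1)) <= rate K ^+ 2]) ->
  \forall K \near \oo, [/\ (K./2 <= K)%N, 0 < rate K,
     lb / 2 <= rate K ^+ 2 * \sum_(K./2 <= k < K) pow_schedule lb a k &
     \sum_(K./2 <= k < K) pow_schedule lb a k ^+ 2 <= 4 * rate K ^+ 2].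
Proof.
move=> a0 a1 Hr; near=> K; have K0 : (0 < K)%N by near: K; exact: near_ge.
have [rK h1 h2] : [/\ 0 < rate K, K%:R `^ (- (1 - a)) <= rate K ^+ 2 &
     K%:R `^ (- (2 * a - 1)) <= rate K ^+ 2] by near: K.
split => //.
- by rewrite -{2}(odd_double_half K) -addnn addnA leq_addl.
- apply: le_trans (ler_wpM2l (sqr_ge0 _) (half_window_sum_ge lb0 a0 K0)).
  apply: le_trans (ler_wpM2r _ h1); last by rewrite mulr_ge0 ?powR_ge0 // ltW // divr_gt0.
  by rewrite mulrCA powRM_N // mulr1.
- apply: le_trans (half_window_sqr_sum_le lb0 lb1 a0 a1 K0) _.
  by rewrite ler_wpM2l.
Unshelve. all: by end_near. Qed.

Lemma sqr_inv_sqrt (x : R) : 0 <= x -> (x `^ (- (1 / 2))) ^+ 2 = x^-1.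
Proof.
move=> x0; rewrite sqr_powR (_ : - (1 / 2) * 2 = -1) ?powR_inv1 //.
by field.
Qed.

Lemma inv_rate : \forall K \near \oo,
  0 < ln K%:R `^ (- (1 / 2)) :> R /\
  lb <= (ln K%:R `^ (- (1 / 2))) ^+ 2 * \sum_(k < K) pow_schedule lb 1 k.
Proof.
near=> K; have l1 : 1 <= ln K%:R :> R by near: K; exact: near_ln_ge.
have l0 : 0 < ln K%:R :> R by exact: lt_le_trans l1.
split; first exact: powR_gt0.
rewrite sqr_inv_sqrt ?(ltW l0) // mulrC ler_pdivlMr //.
have := inv_schedule_window_ge lb0 (leq0n K).
by rewrite subr0 big_mkord.
Unshelve. all: by end_near. Qed.

Lemma inv_schedule_diverges (A : R) :
  \forall K \near \oo, A <= \sum_(k < K) pow_schedule lb 1 k.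
Proof.
near=> K; have := inv_schedule_window_ge lb0 (leq0n K).
rewrite subr0 big_mkord; apply: le_trans.
by rewrite mulrC -ler_pdivrMr //; near: K; exact: near_ln_ge.
Unshelve. all: by end_near. Qed.

(* For a = 1, restarting times k >= (ln K) / 2 keep at least half of the harmonic
   sum, while the sum of the squared parameters is O(1 / ln K). *)
Lemma inv_last_rate :
  \forall K \near \oo, [/\ (Num.trunc (ln K%:R / 2 : R) <= K)%N,
     0 < ln K%:R `^ (- (1 / 2)) :> R,
     lb / 2 <= (ln K%:R `^ (- (1 / 2))) ^+ 2 *
       \sum_(Num.trunc (ln K%:R / 2 : R) <= k < K) pow_schedule lb 1 k &
     \sum_(Num.trunc (ln K%:R / 2 : R) <= k < K) pow_schedule lb 1 k ^+ 2 <=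
       4 * (ln K%:R `^ (- (1 / 2))) ^+ 2].
Proof.
near=> K; have l1 : 1 <= ln K%:R :> R by near: K; exact: near_ln_ge.
have K0 : (0 < K)%N by near: K; exact: near_ge.
have l0 : 0 < ln K%:R :> R by exact: lt_le_trans l1.
set m := Num.trunc _.
have l20 : 0 <= ln K%:R / 2 :> R by rewrite divr_ge0 // ltW.
have m_le : m%:R <= ln K%:R / 2 :> R by rewrite truncn_le.
have m_gt : ln K%:R / 2 < m.+1%:R :> R by exact: truncnS_gt.
have mK : (m <= K)%N.
  rewrite -(ler_nat R) (le_trans m_le) // ler_pdivrMr //.
  have Kr : 0 < K%:R :> R by rewrite ltr0n.
  by have := ln_diff_le Kr ltr01; rewrite ln1 subr0 divr1; lra.
split => //; first exact: powR_gt0.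
- rewrite sqr_inv_sqrt ?(ltW l0) // [leRHS]mulrC ler_pdivlMr //.
  apply: le_trans (inv_schedule_window_ge lb0 mK).
  by rewrite -mulrA ler_wpM2l ?(ltW lb0) //; lra.
- rewrite sqr_inv_sqrt ?(ltW l0) //.
  apply: le_trans (inv_schedule_sqr_window_le lb0 lb1 mK) _.
  rewrite ler_pdivrMr // mulrAC ler_pdivlMr //.
  by move: m_gt; lra.
Unshelve. all: by end_near. Qed.

Lemma log_rate (a : R) : 0 <= a -> \forall K \near \oo,
  0 < K%:R `^ (- ((1 - a) / 2)) * ln K%:R `^ (1 / 2) :> R /\
  lb / 2 <= (K%:R `^ (- ((1 - a) / 2)) * ln K%:R `^ (1 / 2)) ^+ 2 *
    \sum_(k < K) log_schedule lb a k.
Proof.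
move=> a0; near=> K; have K0 : (0 < K)%N by near: K; exact: near_ge.
have l1 : 1 <= ln K%:R :> R by near: K; exact: near_ln_ge.
have l0 : 0 < ln K%:R :> R by exact: lt_le_trans l1.
(* Replacing [ln (K + e)] by [ln K] costs the factor 2 in [lb / 2]. *)
have el : eln R K <= 2 * ln K%:R by near: K; exact: eln_le_ln.
have e0 := eln_gt0 R K.
split; first by rewrite mulr_gt0 // powR_gt0 // ltr0n.
rewrite exprMn sqr_powR_half sqr_powR (_ : 1 / 2 * 2 = 1); last by field.
rewrite powRr1 ?(ltW l0) //.
apply: le_trans (ler_wpM2l _ (log_schedule_sum_ge lb0 a0 K0)); last first.
  by rewrite mulr_ge0 ?powR_ge0 // ltW.
have -> : K%:R `^ (- (1 - a)) * ln K%:R * (lb * K%:R `^ (1 - a) / eln R K) =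
    (K%:R `^ (- (1 - a)) * K%:R `^ (1 - a)) * (lb * (ln K%:R / eln R K)) by ring.
rewrite powRM_N // mul1r ler_wpM2l ?(ltW lb0) // ler_pdivlMr //; lra.
Unshelve. all: by end_near. Qed.

Lemma log_schedule_diverges (a A : R) : 0 <= a -> a < 1 ->
  \forall K \near \oo, A <= \sum_(k < K) log_schedule lb a k.
Proof.
move=> a0 a1; near=> K; have K0 : (0 < K)%N by near: K; exact: near_ge.
have l1 : 1 <= ln K%:R :> R by near: K; exact: near_ln_ge.
have l0 : 0 < ln K%:R :> R by exact: lt_le_trans l1.
have el : eln R K <= 2 * ln K%:R by near: K; exact: eln_le_ln.
have e0 := eln_gt0 R K.
apply: le_trans (log_schedule_sum_ge lb0 a0 K0).
have h : 2 * `|A| / lb <= K%:R `^ (1 - a) / ln K%:R.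
  by near: K; apply: near_powR_ln_ge; rewrite subr_gt0.
rewrite ler_pdivrMr // mulrAC ler_pdivlMr // in h.
rewrite ler_pdivlMr // [leRHS]mulrC; apply: le_trans h.
apply: (@le_trans _ _ (`|A| * eln R K)).
  by rewrite ler_wpM2r ?(ltW e0) // ler_norm.
have := ler_wpM2l (normr_ge0 A) el; lra.
Unshelve. all: by end_near. Qed.

Lemma log_inv_rate : \forall K \near \oo,
  0 < ln (ln K%:R) `^ (- (1 / 2)) :> R /\
  lb <= (ln (ln K%:R) `^ (- (1 / 2))) ^+ 2 * \sum_(k < K) log_schedule lb 1 k.
Proof.
near=> K; have K0 : (0 < K)%N by near: K; exact: near_ge.
have l1 : 1 <= ln K%:R :> R by near: K; exact: near_ln_ge.
have l0 : 0 < ln K%:R :> R by exact: lt_le_trans l1.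
have ll1 : 1 <= ln (ln K%:R) :> R by near: K; exact: near_lnln_ge.
have ll0 : 0 < ln (ln K%:R) :> R by exact: lt_le_trans ll1.
split; first exact: powR_gt0.
rewrite sqr_inv_sqrt ?(ltW ll0) // mulrC ler_pdivlMr //.
exact: log_inv_schedule_sum_ge.
Unshelve. all: by end_near. Qed.

Lemma log_inv_schedule_diverges (A : R) :
  \forall K \near \oo, A <= \sum_(k < K) log_schedule lb 1 k.
Proof.
near=> K; have K0 : (0 < K)%N by near: K; exact: near_ge.
have l1 : 1 <= ln K%:R :> R by near: K; exact: near_ln_ge.
apply: le_trans (log_inv_schedule_sum_ge lb0 K0 (lt_le_trans ltr01 l1)).
by rewrite mulrC -ler_pdivrMr //; near: K; exact: near_lnln_ge.
Unshelve. all: by end_near. Qed.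
End ScheduleRates.

Theorem mainTheorem5 (R : realType)
  (H : completeNormedModType R) (dot : {dot H for idfun})
  (norm_dot : forall x : H, dot x x = `|x| ^+ 2)
  (H_separable : separable H)
  (dXi : measure_display) (Xi : measurableType dXi) (D : probability Xi R)
  (T : Xi -> H -> H)
  (T_nonexpansive : {ae D, forall s, nonexpansive (T s)})
  (T_measurable : forall x, borel_measurable (fun s => T s x))
  (T_integrable : forall x, bochner_integrable D (fun s => T s x))
  (Fix_nonempty : Fix (mean_operator D T) !=set0)
  (sigma : R) (p0 : H) (p0_fixed : Fix (mean_operator D T) p0)
  (variance_p0 : (\int[D]_s (`|T s p0 - mean_operator D T p0| ^+ 2)%:E
                  <= (sigma ^+ 2)%:E)%E)
  (x0 : H)
  (dOmega : measure_display) (Omega : measurableType dOmega)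
  (P : probability Omega R)
  (lambdabar : R) (lambdabar_gt0 : 0 < lambdabar) (lambdabar_lt1 : lambdabar < 1) :
  (forall (xi : nat -> {RV P >-> Xi}) (a : R), iid_from D xi ->
     1 / 2 < a -> a <= 1 ->
     let lambda := fun k : nat => lambdabar * k.+1%:R `^ (- a) in
     [/\ forall N : nat -> {RV P >-> nat},
           (forall K, (1 <= K)%N -> random_index P lambda xi K (N K)) ->
           expectation_bigO 1
             (fun K => 'E_P[fun w => residual D T lambda x0 xi (N K w) w]%E)
             (fun K => if a < 1 then K%:R `^ (- ((1 - a) / 2))
                       else ln K%:R `^ (- (1 / 2))),
         almost_surely_littleo P (min_residual D T lambda x0 xi)
           (fun K => if a < 1 then K%:R `^ (- ((1 - a) / 2))
                     else ln K%:R `^ (- (1 / 2)))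
       & expectation_bigO 1
           (fun K => 'E_P[residual D T lambda x0 xi K]%E)
           (fun K => if a < 2 / 3 then K%:R `^ (- ((2 * a - 1) / 2))
                     else if a == 2 / 3 then
                       ln K%:R `^ (1 / 2) * K%:R `^ (- (1 / 6))
                     else if a < 1 then K%:R `^ (- ((1 - a) / 2))
                     else ln K%:R `^ (- (1 / 2)))])
  /\
  (forall (xi : nat -> {RV P >-> Xi}) (a : R), iid_from D xi ->
     1 / 2 <= a -> a <= 1 ->
     let lambda := fun k : nat =>
       lambdabar * k.+1%:R `^ (- a) * (ln (k%:R + expR 1))^-1 in
     (forall N : nat -> {RV P >-> nat},
        (forall K, (3 <= K)%N -> random_index P lambda xi K (N K)) ->
        expectation_bigO 3
          (fun K => 'E_P[fun w => residual D T lambda x0 xi (N K w) w]%E)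
          (fun K => if a < 1 then K%:R `^ (- ((1 - a) / 2)) * ln K%:R `^ (1 / 2)
                    else ln (ln K%:R) `^ (- (1 / 2)))) /\
     almost_surely_littleo P (min_residual D T lambda x0 xi)
       (fun K => if a < 1 then K%:R `^ (- ((1 - a) / 2)) * ln K%:R `^ (1 / 2)
                 else ln (ln K%:R) `^ (- (1 / 2))))
  /\
  (forall (xi : nat -> nat -> {RV P >-> Xi}) (a : R),
     (forall K, (1 <= K)%N -> iid_from D (xi K)) ->
     1 / 2 <= a -> a < 1 ->
     let lambda := fun K k : nat => lambdabar * K%:R `^ (- a) in
     (forall N : nat -> {RV P >-> nat},
        (forall K, (1 <= K)%N -> random_index P (lambda K) (xi K) K (N K)) ->
        expectation_bigO 1
          (fun K => 'E_P[fun w => residual D T (lambda K) x0 (xi K) (N K w) w]%E)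
          (fun K => K%:R `^ (- (Num.min a (1 - a) / 2)))) /\
     expectation_bigO 1
       (fun K => 'E_P[residual D T (lambda K) x0 (xi K) K]%E)
       (fun K => K%:R `^ (- (Num.min (- 1 + 2 * a) (1 - a) / 2)))).
Proof.
split; [|split].
- move=> xi a iid a12 a1 lambda.
  have a0 : 0 <= a by lra.
  have l0 k : 0 < lambda k by exact: pow_schedule_gt0.
  have l1 k : lambda k <= lambdabar by exact: pow_schedule_le.
  have lQ K : \sum_(k < K) lambda k ^+ 2 <= 1 + (2 * a - 1)^-1.
    exact: pow_schedule_sqr_sum.
  have index := index_bigO norm_dot H_separable T_nonexpansive T_measurable
    T_integrable p0_fixed variance_p0 x0 lambdabar_lt1 iid l0 l1 lQ.
  have last := last_bigO norm_dot H_separable T_nonexpansive T_measurable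
    T_integrable p0_fixed variance_p0 x0 lambdabar_lt1 iid l0 l1 lQ.
  have minr := min_littleo norm_dot H_separable T_nonexpansive T_measurable
    T_integrable p0_fixed variance_p0 x0 lambdabar_lt1 iid l0 l1 lQ.
  have lb2 : 0 < lambdabar / 2 by exact: divr_gt0.
  have [a_lt1|] := ltP a 1; last first.
    move=> a_ge1; have a_eq1 : a = 1 by apply/eqP; rewrite eq_le a1.
    have -> : (a < 2 / 3) = false by apply/negbTE; rewrite -leNgt; lra.
    have -> : (a == 2 / 3) = false by apply/negbTE/eqP; lra.
    rewrite a_eq1 in lambda l0 l1 lQ index last minr *.
    split.
    + move=> N NK; exact: (index 1%N N _ lambdabar isT NK lambdabar_gt0
        (inv_rate lambdabar_gt0)).
    + exact: (minr _ lambdabar lambdabar_gt0 (inv_schedule_diverges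
        lambdabar_gt0) (inv_rate lambdabar_gt0)).
    + exact: (last _ _ _ _ lb2 (inv_last_rate lambdabar_gt0 lambdabar_lt1)).
  split.
  + move=> N NK; exact: (index 1%N N _ lambdabar isT NK lambdabar_gt0 (pow_rate
      lambdabar_gt0 a0)).
  + exact: (minr _ lambdabar lambdabar_gt0
      (fun A => pow_schedule_diverges lambdabar_gt0 A a0 a_lt1) (pow_rate
        lambdabar_gt0 a0)).
  + apply: (last _ _ _ _ lb2 (pow_last_rate lambdabar_gt0 lambdabar_lt1 a0 a1 _)).
    near=> K.
    have K0 : (0 < K)%N by near: K; exact: near_ge.
    have Kr : 0 < K%:R :> R by rewrite ltr0n.
    have K1 : 1 <= K%:R :> R by rewrite ler1n.
    have lnK : 1 <= ln K%:R :> R by near: K; exact: near_ln_ge.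
    have mono (s t : R) : s <= t -> K%:R `^ s <= K%:R `^ t :> R by exact:
      ler_powR.
    have [a23|a23] := ltP a (2 / 3).
      by split; rewrite ?powR_gt0 // sqr_powR_half; apply: mono; lra.
    have [a_eq|a_neq] := eqVneq a (2 / 3).
      have -> : (ln K%:R `^ (1 / 2) * K%:R `^ (- (1 / 6))) ^+ 2 =
          ln K%:R * K%:R `^ (- (1 / 3)) :> R.
        rewrite exprMn !sqr_powR; congr (_ * _); last by congr (_ `^ _); field.
        rewrite (_ : 1 / 2 * 2 = 1); last by field.
        by rewrite powRr1 // (le_trans ler01).
      (* At [a = 2/3] both exponents equal [-1/3], so the argument loses no logarithm; the stated
         rate is weaker because [ln K >= 1]. *)
      have key (s : R) : s <= - (1 / 3) -> K%:R `^ s <= ln K%:R * K%:R `^ (- (1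
        / 3)) :> R.
        move=> hs; apply: le_trans (mono _ _ hs) _.
        by rewrite ler_peMl ?powR_ge0.
      split; [|by apply: key; lra|by apply: key; lra].
      by rewrite mulr_gt0 // powR_gt0 // (lt_le_trans ltr01).
    by split; rewrite ?powR_gt0 // sqr_powR_half; apply: mono; lra.
- move=> xi a iid a12 a1 lambda.
  have a0 : 0 <= a by lra.
  have l0 k : 0 < lambda k by exact: log_schedule_gt0.
  have l1 k : lambda k <= lambdabar by exact: log_schedule_le.
  have lQ K : \sum_(k < K) lambda k ^+ 2 <= 2 * (1 + expR 1).
    exact: log_schedule_sqr_sum.
  have index := index_bigO norm_dot H_separable T_nonexpansive T_measurable
    T_integrable p0_fixed variance_p0 x0 lambdabar_lt1 iid l0 l1 lQ.
  have minr := min_littleo norm_dot H_separable T_nonexpansive T_measurable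
    T_integrable p0_fixed variance_p0 x0 lambdabar_lt1 iid l0 l1 lQ.
  have lb2 : 0 < lambdabar / 2 by exact: divr_gt0.
  have [a_lt1|a_ge1] := ltP a 1.
    split.
    + move=> N NK; exact: (index 3%N N _ _ isT NK lb2 (log_rate lambdabar_gt0
        a0)).
    + exact: (minr _ _ lb2 (fun A => log_schedule_diverges lambdabar_gt0 A a0
        a_lt1)
        (log_rate lambdabar_gt0 a0)).
  have a_eq1 : a = 1 by apply/eqP; rewrite eq_le a1.
  rewrite a_eq1 in lambda l0 l1 lQ index minr *.
  split.
  + move=> N NK; exact: (index 3%N N _ _ isT NK lambdabar_gt0 (log_inv_rate
      lambdabar_gt0)).
  + exact: (minr _ _ lambdabar_gt0 (log_inv_schedule_diverges lambdabar_gt0)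
      (log_inv_rate lambdabar_gt0)).
- move=> xi a iid a12 a1 lambda.
  have d0 : 0 < 1 - lambdabar by rewrite subr_gt0.
  have l0 K k : 0 <= lambda K k by rewrite mulr_ge0 ?powR_ge0 // ltW.
  have aux K : (0 < K)%N -> [/\ forall k, 1 - lambdabar <= 1 - lambda K k,
      forall k, 0 < lambda K k,
      \sum_(k < K) lambda K k = lambdabar * K%:R `^ (1 - a),
      \sum_(k < K) lambda K k ^+ 2 <= K%:R `^ (- (2 * a - 1)) &
      K%:R `^ (- (2 * a - 1)) <= 1].
    (* For horizon [K.+1] the constant value is [pow_schedule] at index [K], so the pointwise
       estimates for the decreasing schedule apply. *)
    case: K => // K _; split.
    + move=> k; rewrite lerD2l lerN2; apply: pow_schedule_le => //; lra.
    + move=> k; exact: pow_schedule_gt0.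
    + by rewrite sumr_const card_ord -powR_1B // -[LHS]mulr_natl mulrCA.
    + rewrite /lambda sumr_const card_ord opprB -powR_1B // -[leLHS]mulr_natl
        ler_wpM2l //.
      exact: pow_schedule_sqr_le.
    + by apply: powR_inv_le1; lra.
  have lQ K : (0 < K)%N -> \sum_(k < K) lambda K k ^+ 2 <= 1.
    by move=> /aux[_ _ _ h1 h2]; exact: le_trans h1 h2.
  split.
  (* Samples and parameter both change with [K], so the estimates for a single horizon are applied
     at each [K]; their constants are uniform because [Q = 1] works for all horizons. *)
  + move=> N NK; apply: expectation_bigO_intro => [K|K K0|].
    * by apply: expectation_ge0 => w; exact: normr_ge0.
    * have [ld lgt SK _ _] := aux K K0; eexists.
      apply: (index_rate norm_dot H_separable T_nonexpansive T_measurable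
        T_integrable p0_fixed variance_p0 x0 d0 (iid K K0) (l0 K) ld (lQ K K0)
          (NK K K0)
        ltr01 lambdabar_gt0).
      rewrite expr1n mul1r SK ler_peMr ?(ltW lambdabar_gt0) //.
      rewrite -[leLHS](powRr0 (K%:R : R)) ler_powR ?ler1n //; lra.
    * eexists; near=> K; have K0 : (0 < K)%N by near: K; exact: near_ge.
      have [ld lgt SK _ _] := aux K K0.
      have rK : 0 < K%:R `^ (- (Num.min a (1 - a) / 2)) :> R by rewrite
        powR_gt0 // ltr0n.
      split; first exact: ltW.
      apply: (index_rate norm_dot H_separable T_nonexpansive T_measurable
        T_integrable p0_fixed variance_p0 x0 d0 (iid K K0) (l0 K) ld (lQ K K0)
          (NK K K0)
        rK lambdabar_gt0).
      (* Here [a >= 1/2], so the minimum is always its second argument. *)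
      have -> : Num.min a (1 - a) = 1 - a by apply: min_r; lra.
      by rewrite SK sqr_powR_half mulrCA powRM_N // mulr1.
  + apply: expectation_bigO_intro => [K|K K0|].
    * by apply: expectation_ge0 => w; exact: normr_ge0.
    * have [ld lgt SK _ _] := aux K K0; eexists.
      apply: (last_rate norm_dot H_separable T_nonexpansive T_measurable
        T_integrable p0_fixed variance_p0 x0 d0 (iid K K0) (l0 K) ld (lQ K K0)
          (leq0n K)
        ltr01 lambdabar_gt0).
        rewrite expr1n mul1r big_mkord SK ler_peMr ?(ltW lambdabar_gt0) //.
        rewrite -[leLHS](powRr0 (K%:R : R)) ler_powR ?ler1n //; lra.
      by rewrite expr1n mulr1 big_mkord; exact: lQ.
    * eexists; near=> K; have K0 : (0 < K)%N by near: K; exact: near_ge.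
      have [ld lgt SK S2 _] := aux K K0.
      have K1 : 1 <= K%:R :> R by rewrite ler1n.
      set e := Num.min _ _.
      have rK : 0 < K%:R `^ (- (e / 2)) :> R by rewrite powR_gt0 // ltr0n.
      have e1 : e <= 1 - a by rewrite /e ge_min lexx orbT.
      have e2 : e <= - 1 + 2 * a by rewrite /e ge_min lexx.
      split; first exact: ltW.
      (* The window starts at 0: with a constant parameter the whole sum of squares is already at
         most [K^(-(2a-1))], hence [c2 = 1]. *)
      apply: (last_rate norm_dot H_separable T_nonexpansive T_measurable
        T_integrable p0_fixed variance_p0 x0 d0 (iid K K0) (l0 K) ld (lQ K K0)
          (leq0n K)
        rK lambdabar_gt0 _ (c2 := 1)).
        rewrite big_mkord SK sqr_powR_half mulrCA ler_peMr ?(ltW lambdabar_gt0)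
          //.
        rewrite -[leLHS](powRM_N (1 - a) K0) ler_wpM2r ?powR_ge0 // ler_powR
          //; lra.
      rewrite big_mkord mul1r sqr_powR_half; apply: le_trans S2 _.
      by rewrite ler_powR //; lra.
Unshelve. all: by end_near. Qed.
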